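(* Let $G_m$ be a bounded Vilenkin group. a) Let $0<p\leq 1$ and let $\{\alpha_k : k\in\mathbb{N}\}$ be a subsequence of the positive integers such that $$\sup_{k\in\mathbb{N}}\rho(\alpha_k)=:\varkappa<\infty .$$ Then the maximal operator $$\widetilde{S}^{\ast,\vartriangle}f:=\sup_{k\in\mathbb{N}}|S_{\alpha_k}f|$$ is bounded from the Hardy space $H_p(G_m)$ to the Lebesgue space $L_p(G_m)$; that is, there is a finite constant $C$, independent of $f$, such that $\|\widetilde{S}^{\ast,\vartriangle}f\|_p\leq C\|f\|_{H_p}$ for all $f\in H_p(G_m)$. b) Let $0<p<1$ and let $\{\alpha_k : k\in\mathbb{N}\}$ be a subsequence of the positive integers satisfying $$\sup_{k\in\mathbb{N}}\rho(\alpha_k)=\infty .$$ Then there exists a martingale $f\in H_p(G_m)$ such that $$\sup_{k\in\mathbb{N}}\|S_{\alpha_k}f\|_{L_{p,\infty}}=\infty .$$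
   Context: $\mathbb{N}_+=\{1,2,\dots\}$, $\mathbb{N}=\mathbb{N}_+\cup\{0\}$. Let $m=(m_0,m_1,\dots)$ be a bounded sequence of integers $m_k\geq 2$. $Z_{m_k}=\{0,1,\dots,m_k-1\}$ is the additive group of integers modulo $m_k$ with the discrete topology, and $G_m=\prod_{k\ge 0} Z_{m_k}$ is the complete direct product with the product topology (a bounded Vilenkin group). $\mu$ is the product of the uniform probability measures on the $Z_{m_k}$, i.e. the Haar measure of $G_m$ with $\mu(G_m)=1$. Elements are written $x=(x_0,x_1,\dots)$, $x_k\in Z_{m_k}$. Put $I_0(x)=G_m$ and $I_n(x)=\{y\in G_m: y_0=x_0,\dots,y_{n-1}=x_{n-1}\}$. Let $M_0=1$, $M_{k+1}=m_kM_k$. Every $n\in\mathbb{N}$ is uniquely $n=\sum_{j=0}^\infty n_jM_j$ with $n_j\in Z_{m_j}$, only finitely many $n_j$ nonzero. For $n\ge 1$ put $\langle n\rangle=\min\{j: n_j\neq 0\}$, $|n|=\max\{j:n_j\neq 0\}$ and $\rho(n)=|n|-\langle n\rangle$. Generalized Rademacher functions: $r_k(x)=\exp(2\pi i x_k/m_k)$. Vilenkin system: $\psi_n(x)=\prod_{k=0}^\infty r_k(x)^{n_k}$, $n\in\mathbb{N}$. For $0<p<\infty$, $\|f\|_p=(\int_{G_m}|f|^pd\mu)^{1/p}$, and $\|f\|_{L_{p,\infty}}=\sup_{\lambda>0}\lambda\,\mu(\{|f|>\lambda\})^{1/p}$. Let $\mathcal{F}_n$ be the $\sigma$-algebra generated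 by $\{I_n(x):x\in G_m\}$. Martingales $f=(f_n:n\in\mathbb{N})$ are with respect to $(\mathcal{F}_n)$. The maximal function is $f^*=\sup_{n}|f_n|$, and for $0<p<\infty$ the martingale Hardy space $H_p(G_m)$ consists of all martingales with $\|f\|_{H_p}:=\|f^*\|_p<\infty$. The Vilenkin-Fourier coefficients of a martingale $f$ are $\widehat f(i)=\lim_{k\to\infty}\int_{G_m}f_k\overline{\psi_i}\,d\mu$, and the partial sums are $S_nf=\sum_{k=0}^{n-1}\widehat f(k)\psi_k$ for $n\in\mathbb{N}_+$, with $S_0f=0$. *)

(* Defs.v *)
From HB Require Import structures.
From mathcomp Require Import all_boot all_order all_algebra.
From mathcomp Require Import complex.
From mathcomp Require Import all_classical all_reals all_analysis.

Set Implicit Arguments.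
Unset Strict Implicit.
Unset Printing Implicit Defensive.

Import Order.TTheory GRing.Theory Num.Theory.
Import numFieldNormedType.Exports.

Local Open Scope classical_set_scope.
Local Open Scope ring_scope.

(* The definitions below are meaningful only when 1 < m k for all k: the type
   'Z_n is Z/n for n > 1, but Z/2 for n <= 1. *)

Section vilenkin_group.
Variable m : nat -> nat.

Definition bounded_generating : Prop :=
  (forall k, (2 <= m k)%N) /\ (exists B, forall k, (m k <= B)%N).

Definition vilenkin : Type := forall k : nat, 'Z_(m k).

HB.instance Definition _ := gen_eqMixin vilenkin.
HB.instance Definition _ := gen_choiceMixin vilenkin.
HB.instance Definition _ := isPointed.Build vilenkin (fun k => 0).

(* Generators of the product sigma-algebra; it is the Borel sigma-algebra of the
   product topology, as the latter has a countable base of such finite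
   intersections. *)
Definition coordinate_sets : set (set vilenkin) :=
  [set A | exists k (B : {set 'Z_(m k)}), A = [set x | x k \in B]].

Definition Gm : Type := g_sigma_algebraType coordinate_sets.

Definition vint (n : nat) (x : Gm) : set Gm :=
  [set y | forall k, (k < n)%N -> y k = x k].

Definition vfiltration (n : nat) : set (set Gm) := <<s range (vint n) >>.

Definition gprod (k : nat) : nat := (\prod_(j < k) m j)%N.

(* The coefficient n_j of the expansion n = \sum_j n_j M_j with 0 <= n_j < m_j,
   where M_j = gprod j = m_0 ... m_(j-1). *)
Definition vdigit (n j : nat) : nat := ((n %/ gprod j) %% m j)%N.

(* Since n < 2 ^ n <= M_n, all digits of index >= n vanish; this is why the
   ranges below stop at n. For n >= 1 the set of indices of nonzero digits is
   nonempty, so the default values are never returned. *)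
Definition vlow (n : nat) : nat :=
  (\big[minn/n]_(j < n | vdigit n j != 0%N) j)%N.
Definition vhigh (n : nat) : nat := (\max_(j < n | vdigit n j != 0%N) j)%N.
Definition vrho (n : nat) : nat := (vhigh n - vlow n)%N.

End vilenkin_group.

Section vilenkin_fourier.
Variables (R : realType) (m : nat -> nat).
Local Notation G := (Gm m).

(* |z| as a real number; Num.norm on R[i] takes its values in R[i] *)
Definition cmod (z : R[i]) : R := ComplexField.Normc.normc z.

Definition rademacher (k : nat) (x : G) : R[i] :=
  let t := 2 * pi * (x k : nat)%:R / (m k)%:R in (cos t +i* sin t)%C.

(* The product over all k reduces to k < n, since n_k = 0 for k >= n. *)
Definition psi (n : nat) (x : G) : R[i] :=
  \prod_(k < n) rademacher k x ^+ vdigit m n k.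

(* The values on finite-dimensional rectangles determine a finite measure on
   coordinate_sets.-sigma, so this says that mu is the product of the uniform
   probability measures on the 'Z_(m k), i.e. the normalized Haar measure. *)
Definition is_product_measure (mu : set G -> \bar R) : Prop :=
  forall (n : nat) (B : forall k, {set 'Z_(m k)}),
    mu [set x | forall k, (k < n)%N -> x k \in B k] =
      (\prod_(k < n) (#|B k|%:R / (m k)%:R))%:E.

Variable mu : {measure set G -> \bar R}.

Definition cintegral (A : set G) (f : G -> R[i]) : R[i] :=
  (Rintegral mu A (fun x => complex.Re (f x))
   +i* Rintegral mu A (fun x => complex.Im (f x)))%C.

Definition cintegrable (f : G -> R[i]) : Prop :=
  mu.-integrable setT (fun x => (complex.Re (f x))%:E) /\
  mu.-integrable setT (fun x => (complex.Im (f x))%:E).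

Definition vmeasurable (n : nat) (f : G -> R[i]) : Prop :=
  forall B : set R, measurable B ->
    vfiltration n [set x | B (complex.Re (f x))] /\
    vfiltration n [set x | B (complex.Im (f x))].

(* The last clause is E[f_k | F_n] = f_n for n <= k. *)
Definition martingale (f : nat -> G -> R[i]) : Prop :=
  [/\ forall n, vmeasurable n (f n),
      forall n, cintegrable (f n) &
      forall n k A, (n <= k)%N -> vfiltration n A ->
        cintegral A (f k) = cintegral A (f n)].

(* sup_n |g_n|, with values in \bar R; used both for f^* and for the maximal
   operators of partial sums *)
Definition sup_mod (g : nat -> G -> R[i]) (x : G) : \bar R :=
  ereal_sup (range (fun n => (cmod (g n x))%:E)).

Definition hardy_norm (p : R) (f : nat -> G -> R[i]) : \bar R :=
  Lnorm mu p%:E (sup_mod f).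

Definition hardy (p : R) : set (nat -> G -> R[i]) :=
  [set f | martingale f /\ (hardy_norm p f < +oo)%E].

Definition weak_Lnorm (p : R) (f : G -> R[i]) : \bar R :=
  ereal_sup [set (l%:E * mu [set x | (l < cmod (f x))%R] `^ p^-1)%E
            | l in [set l : R | 0 < l]].

(* R[i]^o carries the topology of the complex plane. *)
Definition vcoef (f : nat -> G -> R[i]) (i : nat) : R[i] :=
  lim ((fun k => cintegral setT (fun x => f k x * (psi i x)^*%C) : R[i]^o)
       @ \oo).

Definition vsum (n : nat) (f : nat -> G -> R[i]) (x : G) : R[i] :=
  \sum_(k < n) vcoef f k * psi k x.

End vilenkin_fourier.

(* Main.v *)
Require Import Defs.
From mathcomp Require Import all_boot all_order all_algebra.
From mathcomp Require Import complex zify ring lra.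
From mathcomp Require Import all_classical all_reals all_analysis.
From mathcomp Require Import measurable_realfun.

(** Both halves rest on the shape of the Dirichlet kernel [D_a] for [s = <a>]
    and [t = |a|]. As [M_s] divides [a], the kernel is a combination of full
    blocks of [M_s] consecutive characters, and therefore vanishes off the atom
    of level [s] around the origin ([dirichlet_eq0]); on some neighbouring atom
    of level [s + 1] it has size comparable to [M_s] ([dirichlet_lower]).

    Part a). Trivially [|D_a| <= a < M_(t+1)], so [|S_a f (x)|] is at most the
    sum of [|f_(t+1)|] over the atoms of level [t + 1] inside the atom of level
    [s] of [x]. When [t - s] stays bounded there are boundedly many of them. On
    each, [|f_(t+1)|] is at most every value that the maximal function [f^*]
    takes there, hence for [q = p / 2] its power [q] is at most a constant times
    the mean of [(f^* )^q] over the atom of level [s] ([martingale_le_avg],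
    [vsum_le_avg]). The maximal operator to the power [q] is thus dominated by
    the martingale maximal function of [(f^* )^q], and Doob's inequality in L^2
    ([doob_max_class_avg]) gives the bound in L^p ([max_vsum_finite]). All of
    this takes place on finitely many atoms; monotone convergence does the rest
    ([Lnorm_max_vsum]).

    Part b). The martingale is [f_n = sum_(j < n) c_j (D_(M_(j+1)) - D_(M_j))]
    with a sparse sequence [c]. Its norm in [H_p] is controlled by
    [sum_j c_j^p M_j^(p-1)] ([hump_hardy]), while
    [S_a f = f_t + c_t (D_a - D_(M_t))] ([vsum_hump]) exceeds a constant times
    [c_t M_s] on an atom of level [s + 1], provided that [f_t] is small compared
    with it; its weak norm is then at least a constant times
    [c_t M_s^(1 - 1/p)] ([weak_Lnorm_hump]). For [c_t = 2^(-k/p) M_t^(1/p - 1)]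
    this is [2^(-k/p) (M_t / M_s)^(1/p - 1)], which is arbitrarily large because
    [M_t / M_s >= 2^(t - s)], [p < 1] and [t - s] is unbounded. Choosing the
    [k]-th index so late that its term beats all earlier ones yields one
    martingale for which the weak norms are unbounded. *)

Set Implicit Arguments.
Unset Strict Implicit.
Unset Printing Implicit Defensive.

Import Order.TTheory GRing.Theory Num.Theory.
Local Open Scope classical_set_scope.
Local Open Scope ring_scope.

(** * Mixed-radix digits *)

Section MixedRadix.
Local Open Scope nat_scope.
Variable m : nat -> nat.
Hypothesis m_ge2 : forall k, 2 <= m k.

Let m_gt0 k : 0 < m k. Proof. exact: ltnW (m_ge2 k). Qed.

Lemma gprodS k : gprod m k.+1 = gprod m k * m k.
Proof. by rewrite /gprod big_ord_recr. Qed.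

Lemma gprod_gt0 k : 0 < gprod m k.
Proof. by rewrite /gprod prodn_gt0. Qed.

Lemma gprod_ge k : 2 ^ k <= gprod m k.
Proof.
by elim: k => [|k IH]; rewrite ?expn0 ?gprod_gt0 // gprodS expnSr leq_mul.
Qed.

Lemma dvdn_gprod i j : i <= j -> gprod m i %| gprod m j.
Proof.
move=> /subnKC<-; elim: (j - i) => [|k IH]; rewrite ?addn0 // addnS gprodS.
exact: dvdn_mulr.
Qed.

Lemma leq_gprod i j : i <= j -> gprod m i <= gprod m j.
Proof. by move=> ij; rewrite dvdn_leq ?gprod_gt0 ?dvdn_gprod. Qed.

Lemma ltn_gprod n : n < gprod m n.
Proof. exact: leq_trans (ltn_expl _ _) (gprod_ge n). Qed.

Lemma leq_gprod_addn B s K : (forall k, m k <= B) ->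
  gprod m (s + K) <= B ^ K * gprod m s.
Proof.
move=> mB; elim: K => [|K IH]; first by rewrite addn0 expn0 mul1n.
rewrite addnS gprodS expnSr mulnAC; exact: leq_mul.
Qed.

Lemma vdigit_lt n j : vdigit m n j < m j.
Proof. by rewrite ltn_pmod. Qed.

Lemma vdigit_small n j : n < gprod m j -> vdigit m n j = 0.
Proof. by move=> h; rewrite /vdigit divn_small // mod0n. Qed.

Lemma vdigitDl_dvd s a r j : gprod m s %| a -> j < s ->
  vdigit m (a + r) j = vdigit m r j.
Proof.
move=> sa js; have : gprod m j.+1 %| a by exact: dvdn_trans (dvdn_gprod js) sa.
rewrite gprodS => /dvdnP[q ->]; rewrite /vdigit [_ * m j]mulnC mulnA.
by rewrite divnMDl ?gprod_gt0 // modnMDl.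
Qed.

Lemma vdigit_mod n s j : j < s -> vdigit m (n %% gprod m s) j = vdigit m n j.
Proof.
move=> js; rewrite [in RHS](divn_eq n (gprod m s)).
by rewrite (@vdigitDl_dvd s) ?dvdn_mull.
Qed.

Lemma vdigit_dvd s a j : gprod m s %| a -> j < s -> vdigit m a j = 0.
Proof.
move=> sa js; rewrite -[a]addn0 (@vdigitDl_dvd s) //.
by rewrite vdigit_small // gprod_gt0.
Qed.

(** No carry occurs when a number below [M_s] is added to a multiple of [M_s],
    so digits add up; this makes [psi] multiplicative on such sums. *)
Lemma vdigitD s a r j : gprod m s %| a -> r < gprod m s ->
  vdigit m (a + r) j = vdigit m a j + vdigit m r j.
Proof.
move=> sa rs; case: (ltnP j s) => js.
  by rewrite (vdigitDl_dvd _ sa js) (vdigit_dvd sa js).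
rewrite [vdigit m r j]vdigit_small ?addn0; last first.
  exact: leq_trans rs (leq_gprod js).
rewrite /vdigit; have /dvdnP[c ->] := dvdn_gprod js.
rewrite mulnC !divnMA; case/dvdnP: sa => q ->.
by rewrite divnMDl ?gprod_gt0 // (divn_small rs) addn0 mulnK ?gprod_gt0.
Qed.

Lemma modnM_split i a b : 0 < a -> 0 < b ->
  i %% (a * b) = (i %/ a %% b) * a + i %% a.
Proof.
move=> a0 b0; rewrite {1}(divn_eq i a) {1}(divn_eq (i %/ a) b) mulnDl -addnA.
rewrite -mulnA (mulnC b a) modnMDl modn_small //.
have := ltn_pmod i a0; have := ltn_pmod (i %/ a) b0; nia.
Qed.

Lemma eq_vdigitP n i j :
  (forall k, k < n -> vdigit m i k = vdigit m j k) <->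
  i = j %[mod gprod m n].
Proof.
split=> [|e k kn]; last by rewrite -(vdigit_mod i kn) e vdigit_mod.
elim: n => [|n IH] e; first by rewrite /gprod big_ord0 !modn1.
rewrite gprodS !modnM_split ?gprod_gt0 // IH; last first.
  by move=> k kn; apply: e; exact: ltnW.
by have := e n (ltnSn n); rewrite /vdigit => ->.
Qed.

Lemma vdigit_dvdP n i :
  (forall k, k < n -> vdigit m i k = 0) <-> gprod m n %| i.
Proof.
split=> [h|d k kn]; last exact: vdigit_dvd d kn.
have /eq_vdigitP : forall k, k < n -> vdigit m i k = vdigit m 0 k.
  by move=> k kn; rewrite h // vdigit_small ?gprod_gt0.
by move=> e; rewrite /dvdn e mod0n.
Qed.

(** The inverse of the digit expansion. *)
Definition radix_sum (d : nat -> nat) n := \sum_(k < n) d k * gprod m k.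

Lemma radix_sum_lt d n : (forall k, d k < m k) -> radix_sum d n < gprod m n.
Proof.
move=> dm; elim: n => [|n IH]; first by rewrite /radix_sum big_ord0 gprod_gt0.
rewrite /radix_sum big_ord_recr /= gprodS -/(radix_sum d n).
by have := dm n; nia.
Qed.

Lemma vdigit_radix_sum d n k : (forall k, d k < m k) -> k < n ->
  vdigit m (radix_sum d n) k = d k.
Proof.
move=> dm; elim: n => // n IH; rewrite ltnS leq_eqVlt => /predU1P[->|kn].
  rewrite /radix_sum big_ord_recr /= addnC -/(radix_sum d n) /vdigit.
  rewrite divnMDl ?gprod_gt0 // divn_small ?radix_sum_lt // addn0.
  exact: modn_small.
rewrite /radix_sum big_ord_recr /= addnC -/(radix_sum d n).
by rewrite (@vdigitDl_dvd n) ?dvdn_mull // IH.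
Qed.

Section LowHigh.
Variable n : nat.
Hypothesis n_gt0 : 0 < n.

Let has_digit : exists2 j : 'I_n, vdigit m n j != 0 &
   forall i, i < j -> vdigit m n i = 0.
Proof.
have [j hj] : exists j, (j < n) && (vdigit m n j != 0).
  apply: contrapT => h.
  have /vdigit_dvdP/(dvdn_leq n_gt0) : forall k, k < n -> vdigit m n k = 0.
    move=> k kn; apply/eqP; apply: contraT => nz.
    by case: h; exists k; rewrite kn.
  by rewrite leqNgt ltn_gprod.
have ex : exists j, (j < n) && (vdigit m n j != 0) by exists j.
case: (ex_minnP ex) => {hj}j /andP[jn nz] jmin.
exists (Ordinal jn) => //= i ij; apply/eqP; apply: contraT => inz.
by have := jmin i; rewrite inz (ltn_trans ij jn) leqNgt ij => /(_ isT).
Qed.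

Lemma vlowP : vdigit m n (vlow m n) != 0 /\ gprod m (vlow m n) %| n.
Proof.
case: has_digit => j nz jmin.
suff -> : vlow m n = j by split=> //; apply/vdigit_dvdP.
rewrite /vlow; apply/eqP; rewrite eqn_leq; apply/andP; split.
  by rewrite -minEnat -leEnat; exact: (bigmin_inf j) nz _.
elim/big_ind: _ => [|x y xj yj|i inz]; first exact/ltnW.
  by rewrite leq_min xj.
by rewrite leqNgt; apply: contraNN inz => /jmin ->.
Qed.

Lemma vlow_le_vhigh : vlow m n <= vhigh m n.
Proof.
case: has_digit => j nz jmin.
apply: (@leq_trans j).
  by rewrite /vlow -minEnat -leEnat; exact: (bigmin_inf j) nz _.
exact: (leq_bigmax_cond (F := fun i : 'I_n => i : nat)).
Qed.

Lemma ltn_gprod_vhigh : n < gprod m (vhigh m n).+1.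
Proof.
have digit0 j : vhigh m n < j -> vdigit m n j = 0.
  move=> hj; case: (ltnP j n) => jn; last first.
    by apply: vdigit_small; exact: leq_trans (ltn_gprod n) (leq_gprod jn).
  apply/eqP; apply: contraLR hj => nz; rewrite -leqNgt.
  exact: (leq_bigmax_cond (Ordinal jn)).
(* one digit at a time, down from the trivial bound [n < M_n] *)
have h i : n < gprod m ((vhigh m n).+1 + i) -> n < gprod m (vhigh m n).+1.
  elim: i => [|i IH]; rewrite ?addn0 // addnS gprodS => lt; apply: IH.
  have := digit0 ((vhigh m n).+1 + i); rewrite addSn ltnS leq_addr => /(_ isT).
  rewrite /vdigit modn_small; last by rewrite ltn_divLR ?gprod_gt0 // mulnC.
  by move=> /eqP; rewrite -leqn0 leqNgt divn_gt0 ?gprod_gt0 // -ltnNge.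
apply: (h n); apply: leq_trans (ltn_gprod n) (leq_gprod _).
exact: leq_addl.
Qed.

Lemma gprod_vhigh_le : gprod m (vhigh m n) <= n.
Proof.
have [v0|v0] := eqVneq (vhigh m n) 0; first by rewrite v0 /gprod big_ord0.
case: has_digit => j nz _.
have pos : 0 < #|[pred i : 'I_n | vdigit m n i != 0]|.
  by apply/card_gt0P; exists j.
have [i inz iE] := eq_bigmax_cond (fun i : 'I_n => i : nat) pos.
rewrite -[vhigh m n]/(\max_(j in [pred i : 'I_n | vdigit m n i != 0]) j).
rewrite iE leqNgt; apply: contraNN inz => lt.
by rewrite vdigit_small.
Qed.

End LowHigh.

End MixedRadix.

Lemma big_block (T : Type) (idx : T) {op : Monoid.law idx} (F : nat -> T) q n :
  \big[op/idx]_(k < q * n) F k =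
  \big[op/idx]_(l < q) \big[op/idx]_(r < n) F (l * n + r)%N.
Proof.
rewrite -(big_mkord xpredT F) big_nat_mul big_mkord; apply: eq_bigr => l _.
rewrite mulSn -{1}[(l * n)%N]add0n big_addn addnK big_mkord.
by apply: eq_bigr => r _; rewrite addnC.
Qed.

(** Distributivity, since every tuple of digits belongs to exactly one
    [i < M_n]. It is applied to sums over frequencies as well as to sums over
    points, and so gives both orthogonality relations below. *)
Lemma sum_prod_vdigit (S : comNzRingType) (m : nat -> nat) :
  (forall k, 2 <= m k)%N -> forall n (F : nat -> nat -> S),
  \sum_(i < gprod m n) \prod_(j < n) F j (vdigit m i j) =
  \prod_(j < n) \sum_(d < m j) F j d.
Proof.
move=> m_ge2; elim=> [|n IH] F.
  rewrite big_ord0 (eq_bigr (fun _ => 1)); last by move=> i _; rewrite big_ord0.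
  by rewrite big_const_ord /gprod big_ord0 /= addr0.
rewrite big_ord_recr /= -IH [in RHS]mulr_sumr gprodS.
rewrite mulnC (big_block (fun i => \prod_(j < n.+1) F j (vdigit m i j))).
apply: eq_bigr => d _; rewrite mulr_suml.
apply: eq_bigr => r _; rewrite big_ord_recr /=; congr (_ * _).
  apply: eq_bigr => j _; congr (F j _).
  by rewrite (@vdigitDl_dvd _ m_ge2 n) ?dvdn_mull.
congr (F n _); rewrite /vdigit divnMDl ?gprod_gt0 // divn_small // addn0.
by rewrite modn_small.
Qed.

(** * Doob's maximal inequality for a finite filtration *)

(** The filtration is given by the equivalence relations [e s] whose classes are
    the atoms of level [s]; [class_avg s] is the conditional expectation of
    [Z] for the counting measure. *)
Section FiniteDoob.
Variables (R : realFieldType) (T : finType) (e : nat -> rel T) (Z : T -> R).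
Hypothesis e_equiv : forall s, equivalence_rel (e s).
Hypothesis e_decr : forall s x y, e s.+1 x y -> e s x y.
Hypothesis Z_ge0 : forall x, 0 <= Z x.

Let e_refl s x : e s x x. Proof. by case: (e_equiv s x x x). Qed.
Let e_left s x y z : e s x y -> e s x z = e s y z.
Proof. by case: (e_equiv s x y z) => _ /[apply]. Qed.
Let e_sym s x y : e s x y = e s y x.
Proof. by apply/idP/idP => h; rewrite -(e_left _ h). Qed.

Definition class_avg s x : R := (\sum_(y | e s x y) Z y) / #|e s x|%:R.

Fixpoint max_class_avg s x : R :=
  if s is s'.+1 then Num.max (max_class_avg s' x) (class_avg s x)
  else class_avg 0 x.

Let card_class s x y : e s x y -> #|e s x| = #|e s y|.
Proof. by move=> h; apply: eq_card => z; exact: e_left. Qed.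

Lemma class_avg_ge0 s x : 0 <= class_avg s x.
Proof. by rewrite divr_ge0 ?ler0n // sumr_ge0. Qed.

Lemma max_class_avg_ge0 s x : 0 <= max_class_avg s x.
Proof.
case: s => [|s]; first exact: class_avg_ge0.
by rewrite /= le_max class_avg_ge0 orbT.
Qed.

Lemma class_avg_inv s x y : e s x y -> class_avg s x = class_avg s y.
Proof.
move=> h; rewrite /class_avg (card_class h); congr (_ / _).
by apply: eq_bigl => z; exact: e_left.
Qed.

Lemma max_class_avg_inv s x y :
  e s x y -> max_class_avg s x = max_class_avg s y.
Proof.
elim: s => [|s IH] h /=; first exact: class_avg_inv.
by rewrite IH ?(class_avg_inv h) //; exact: e_decr.
Qed.

Lemma class_avg_le_max s N x : (s <= N)%N -> class_avg s x <= max_class_avg N x.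
Proof.
elim: N => [|N IH]; first by rewrite leqn0 => /eqP->.
rewrite leq_eqVlt => /predU1P[->|sN]; rewrite /= le_max ?lexx ?orbT //.
by rewrite IH.
Qed.

(** Averaging over the classes is self-adjoint and fixes invariant functions. *)
Lemma sum_class_avg s (h : T -> R) :
  (forall x y, e s x y -> h x = h y) ->
  \sum_x class_avg s x * h x = \sum_x Z x * h x.
Proof.
move=> hinv.
pose F y : R := Z y * (h y / #|e s y|%:R).
transitivity (\sum_x \sum_(y | e s x y) F y).
  apply: eq_bigr => x _; rewrite /class_avg mulrAC -mulrA mulr_suml.
  apply: eq_bigr => y xy.
  by rewrite /F (hinv _ _ xy) (card_class xy).
rewrite (exchange_big_dep predT) //=; apply: eq_bigr => y _.
rewrite sumr_const (@eq_card _ _ (e s y)); last first.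
  by move=> x; exact: e_sym.
rewrite /F -[LHS]mulr_natr -!mulrA mulVf ?mulr1 // pnatr_eq0 -lt0n.
by apply/card_gt0P; exists y; exact: e_refl.
Qed.

(** Doob's maximal inequality in L^2. The maximum increases at time [s] only
    where it equals the current average, so each increment can be tested against
    [Z] itself. The increments add up to at most [2 * sum Z * max], from which
    Young's inequality absorbs the maximum. *)
Lemma doob_max_class_avg N :
  \sum_x max_class_avg N x ^+ 2 <= 4 * \sum_x Z x ^+ 2.
Proof.
have sqr_le : \sum_x max_class_avg N x ^+ 2 <=
    2 * \sum_x Z x * max_class_avg N x.
  elim: N => [|N IH].
    rewrite -(sum_class_avg (s := 0)) => [|x y]; last exact: max_class_avg_inv.
    rewrite [leRHS]mulr_sumr; apply: ler_sum => x _ /=.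
    by have := sqr_ge0 (class_avg 0 x); rewrite expr2; lra.
  pose d x := max_class_avg N.+1 x - max_class_avg N x.
  have dE : \sum_x class_avg N.+1 x * d x = \sum_x Z x * d x.
    apply: sum_class_avg => x y xy.
    by rewrite /d (max_class_avg_inv xy) (max_class_avg_inv (e_decr xy)).
  have -> : \sum_x Z x * max_class_avg N.+1 x =
      \sum_x class_avg N.+1 x * d x + \sum_x Z x * max_class_avg N x.
    rewrite dE -big_split /=; apply: eq_bigr => x _; rewrite -mulrDr.
    by rewrite /d subrK.
  rewrite mulrDr addrC; apply: le_trans (lerD IH (lexx _)).
  rewrite mulr_sumr -big_split /=; apply: ler_sum => x _; rewrite /d /=.
  case: (leP (max_class_avg N x) (class_avg N.+1 x)) => h.
    by rewrite expr2; have := sqr_ge0 (max_class_avg N x - class_avg N.+1 x); nra.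
  by rewrite subrr !mulr0 addr0.
have young : 2 * \sum_x Z x * max_class_avg N x <=
    2 * \sum_x Z x ^+ 2 + 2^-1 * \sum_x max_class_avg N x ^+ 2.
  rewrite !mulr_sumr -big_split /=; apply: ler_sum => x _.
  by have := sqr_ge0 (2 * Z x - max_class_avg N x); nra.
by lra.
Qed.

End FiniteDoob.

(** * Atoms and functions of finite level *)

Section Levels.
Variables (R : realType) (m : nat -> nat).
Hypothesis m_ge2 : forall k, (2 <= m k)%N.
Local Notation G := (Gm m).
Local Notation M := (gprod m).

Let m_gt0 k : (0 < m k)%N. Proof. exact: ltnW (m_ge2 k). Qed.

Lemma coord_lt (x : G) k : (x k < m k)%N.
Proof. by rewrite -[X in (_ < X)%N](Zp_cast (m_ge2 k)) ltn_ord. Qed.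

(** For [i < M_n] the points [point i] represent the atoms of level [n], each
    exactly once, and [code n] finds the representative. A function that is
    constant on these atoms becomes a function on ['I_(M_n)], its integral a
    normalized sum, and the atoms of a level [s <= n] become the residue classes
    modulo [M_s]. *)
Definition point (i : nat) : G := fun k => inZp (vdigit m i k).

Definition code n (x : G) : nat := radix_sum m (fun k => x k) n.

Lemma pointE i k : point i k = vdigit m i k :> nat.
Proof.
by rewrite /= modn_small // [X in (_ < X)%N](Zp_cast (m_ge2 k)) vdigit_lt.
Qed.

Lemma code_lt n x : (code n x < M n)%N.
Proof. by apply: radix_sum_lt => // k; exact: coord_lt. Qed.

Lemma vint_point n i j : vint n (point i) (point j) <-> i = j %[mod M n].
Proof.
rewrite -(eq_vdigitP m_ge2); split=> h k kn.
  by rewrite -!pointE h.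
by apply: ord_inj; rewrite !pointE h.
Qed.

Lemma vint_code n x : vint n x (point (code n x)).
Proof.
move=> k kn; apply: ord_inj; rewrite pointE vdigit_radix_sum // => j.
exact: coord_lt.
Qed.

Lemma vint_refl n (x : G) : vint n x x. Proof. by []. Qed.

Lemma vint_sym n (x y : G) : vint n x y -> vint n y x.
Proof. by move=> h k kn; rewrite h. Qed.

Lemma vint_trans n (x y z : G) : vint n x y -> vint n y z -> vint n x z.
Proof. by move=> h1 h2 k kn; rewrite h2 // h1. Qed.

Lemma vint_le n n' (x y : G) : (n <= n')%N -> vint n' x y -> vint n x y.
Proof. by move=> nn h k kn; apply: h; exact: leq_trans kn nn. Qed.

(** Applied to a set, that is to a function with values in [Prop], this says
    that the set is a union of atoms. *)
Definition level n T (f : G -> T) := forall x y, vint n x y -> f x = f y.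

Lemma level_le n n' T (f : G -> T) : (n <= n')%N -> level n f -> level n' f.
Proof. by move=> nn lf x y /(vint_le nn); exact: lf. Qed.

Lemma level_code n T (f : G -> T) x : level n f -> f x = f (point (code n x)).
Proof. by apply; exact: vint_code. Qed.

Lemma measurable_vint n (x : G) : measurable (vint n x).
Proof.
rewrite [X in measurable X](_ : _ = \bigcap_(k in `I_n)
    [set y : G | y k \in [set x k]%SET]).
  apply: bigcap_measurableType => k _; apply: sub_sigma_algebra.
  by exists k, [set x k]%SET.
apply/seteqP; split=> [y h k kn /=|y h k kn]; first by rewrite inE h.
by have := h k kn; rewrite /= inE => /eqP.
Qed.

(** There are only finitely many atoms of level [n]. *)
Lemma level_vfiltration n (A : set G) : level n A -> vfiltration n A.
Proof.
move=> lA.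
pose F i := if (i < M n)%N && `[< A (point i) >] then vint n (point i) else set0.
have -> : A = \bigcup_i F i.
  apply/seteqP; split=> [x Ax|x [i _]].
    exists (code n x) => //; rewrite /F code_lt /=.
    case: asboolP => [_|[]]; last by rewrite -(level_code x lA).
    by apply: vint_sym; exact: vint_code.
  by rewrite /F; case: ifP => // /andP[_ /asboolP Ai] /lA <-.
have [s0 _ sU] := smallest_sigma_algebra setT (range (@vint m n)).
apply: sU => i; rewrite /F; case: ifP => _ //.
by apply: sub_sigma_algebra; exists (point i).
Qed.

Lemma vfiltration_level n (A : set G) : vfiltration n A -> level n A.
Proof.
suff: <<s range (@vint m n) >> `<=` [set A | level n A] by exact.
apply: smallest_sub; last first.
  move=> _ [x _ <-] y z yz; apply/propext; split=> h.
    exact: vint_trans h yz.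
  by apply: vint_trans h _; exact: vint_sym.
split=> [x y _//|B lB x y xy|F lF x y xy].
  by rewrite /setD /mkset (lB _ _ xy).
apply/propext; split=> -[i _ Fi]; exists i => //.
  by rewrite -(lF i _ _ xy).
by rewrite (lF i _ _ xy).
Qed.

Lemma vfiltration_measurable n (A : set G) : vfiltration n A -> measurable A.
Proof.
suff: <<s range (@vint m n) >> `<=` measurable by exact.
apply: smallest_sub; first exact: smallest_sigma_algebra.
by move=> _ [x _ <-]; exact: measurable_vint.
Qed.

(** The fibres of a measurable function are unions of atoms. *)
Lemma vmeasurableP n (f : G -> R[i]) : vmeasurable n f <-> level n f.
Proof.
split=> [mf x y xy|lf B _].
  have [hR _] := mf _ (measurable_set1 (complex.Re (f x))).
  have [_ hI] := mf _ (measurable_set1 (complex.Im (f x))).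
  have /= := vfiltration_level hR xy; have /= := vfiltration_level hI xy.
  case: (f x) => a b; case: (f y) => c d /= e1 e2; congr (_ +i* _)%C.
    by have : [set a] c by rewrite /= -e2.
  by have : [set b] d by rewrite /= -e1.
by split; apply: level_vfiltration => x y xy /=; rewrite (lf _ _ xy).
Qed.

Lemma level_measurable n d (U : measurableType d) (f : G -> U) :
  level n f -> measurable_fun setT f.
Proof.
move=> lf _ B _; rewrite setTI; apply: (@vfiltration_measurable n).
by apply: level_vfiltration => x y xy; rewrite /preimage /mkset (lf _ _ xy).
Qed.

Variable mu : probability G R.
Hypothesis hmu : is_product_measure mu.

Lemma mu_vint n x : mu (vint n x) = ((M n)%:R^-1)%:E.
Proof.
have := hmu n (fun k => [set x k]%SET).
have -> : [set y : G | forall k, (k < n)%N -> y k \in [set x k]%SET] = vint n x.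
  apply/seteqP; split=> y h k kn; have := h k kn; rewrite ?inE.
    by move/eqP.
  by move=> ->.
move=> ->; congr (_%:E); rewrite /gprod.
rewrite (eq_bigr (fun k : 'I_n => (m k)%:R^-1)); last first.
  by move=> k _; rewrite cards1 mul1r.
by rewrite natr_prod; elim/big_rec2: _ => [|k y z _ ->]; rewrite ?invr1 // invfM.
Qed.

Lemma level_sum_indic n (f : G -> R) x : level n f ->
  f x = \sum_(i < M n) f (point i) * \1_(vint n (point i)) x.
Proof.
move=> lf; rewrite (bigD1 (Ordinal (code_lt n x))) //= big1 ?addr0.
  by rewrite indicE mem_set ?mulr1 -?(level_code x lf) //; exact/vint_sym/vint_code.
move=> i ic; rewrite indicE memNset ?mulr0 // => h.
case/eqP: ic; apply: val_inj => /=.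
have /vint_point : vint n (point i) (point (code n x)).
  by apply: vint_trans h _; exact: vint_code.
by rewrite !modn_small ?code_lt.
Qed.

Let integrable_indic_vint n i (c : R) : mu.-integrable setT
   (fun x => c%:E * (\1_(vint n (point i)) x)%:E)%E.
Proof.
by apply: integrableZl => //; apply: integrable_indic; exact: measurable_vint.
Qed.

Lemma level_integrable n (f : G -> R) : level n f ->
  mu.-integrable setT (EFin \o f).
Proof.
move=> lf; rewrite [X in _.-integrable _ X](_ : _ = fun x =>
   (\sum_(i < M n) (f (point i))%:E * (\1_(vint n (point i)) x)%:E)%E).
  by apply: integrable_sum => // i _; exact: integrable_indic_vint.
by apply/funext => x /=; rewrite (level_sum_indic x lf) -sumEFin.
Qed.

Lemma level_integral n (f : G -> R) : level n f ->
  (\int[mu]_x (f x)%:E = ((\sum_(i < M n) f (point i)) / (M n)%:R)%:E)%E.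
Proof.
move=> lf; rewrite (eq_integral (fun x =>
   (\sum_(i < M n) (f (point i))%:E * (\1_(vint n (point i)) x)%:E)%E)).
  rewrite integral_sum; last 2 first.
  - exact: measurableT.
  - by move=> i; exact: integrable_indic_vint.
  rewrite mulr_suml -sumEFin; apply: eq_bigr => i _.
  rewrite integralZl //; last first.
    by apply: integrable_indic; exact: measurable_vint.
  rewrite integral_indic //; last exact: measurable_vint.
  by rewrite setIT EFinM; congr (_ * _)%E; exact: mu_vint.
by move=> x _; rewrite (level_sum_indic x lf) -sumEFin.
Qed.

Lemma level_Rintegral n (f : G -> R) (A : set G) : level n f -> level n A ->
  Rintegral mu A f = (\sum_(i < M n | point i \in A) f (point i)) / (M n)%:R.
Proof.
move=> lf lA; rewrite Rintegral_mkcond /Rintegral (@level_integral n) /=.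
  by rewrite [in RHS]big_mkcond.
move=> x y xy; rewrite /patch (lf _ _ xy).
by have -> : (x \in A) = (y \in A) by rewrite /in_mem /= /in_set (lA _ _ xy).
Qed.

End Levels.

(** * Complex modulus and roots of unity *)

Section ComplexModulus.
Variable R : realType.
Implicit Types z : R[i].

Lemma cmodE z : `|z| = (cmod z)%:C%C.
Proof. by case: z. Qed.

Lemma cmod_ge0 z : 0 <= cmod z.
Proof. by case: z => a b; exact: sqrtr_ge0. Qed.

Lemma cmodD z1 z2 : cmod (z1 + z2) <= cmod z1 + cmod z2.
Proof. exact: le_normcD. Qed.

Lemma cmodN z : cmod (- z) = cmod z. Proof. exact: normcN. Qed.

Lemma cmodB z1 z2 : cmod z1 - cmod z2 <= cmod (z1 - z2).
Proof.
by rewrite lerBlDr; apply: le_trans (cmodD _ _); rewrite subrK.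
Qed.

Lemma cmodM z1 z2 : cmod (z1 * z2) = cmod z1 * cmod z2.
Proof. exact: ComplexField.Normc.normcM. Qed.

Lemma cmod0 : cmod (0 : R[i]) = 0.
Proof. exact: ComplexField.Normc.normc0. Qed.

Lemma cmod1 : cmod (1 : R[i]) = 1.
Proof. exact: ComplexField.Normc.normc1. Qed.

Lemma cmodJ z : cmod (z^*)%C = cmod z.
Proof. by apply: (@complexI R); rewrite -!cmodE normcJ. Qed.

Lemma conjcX z n : ((z ^+ n)^*)%C = (z^*)%C ^+ n.
Proof. exact: (rmorphXn (@conjc R)). Qed.

Lemma conjcM z1 z2 : ((z1 * z2)^*)%C = (z1^*)%C * (z2^*)%C.
Proof. exact: (rmorphM (@conjc R)). Qed.

Lemma conjc_prod (I : Type) (r : seq I) (P : pred I) (F : I -> R[i]) :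
  ((\prod_(i <- r | P i) F i)^*)%C = \prod_(i <- r | P i) (F i)^*%C.
Proof. exact: (rmorph_prod (@conjc R)). Qed.

Lemma cmod_real (a : R) : cmod (a%:C)%C = `|a|.
Proof. by rewrite /cmod /= expr0n addr0 sqrtr_sqr. Qed.

Lemma cmod_nat n : cmod (n%:R : R[i]) = n%:R.
Proof. by rewrite -(rmorph_nat (real_complex R)) cmod_real normr_nat. Qed.

Lemma cmod_sum (I : Type) (r : seq I) (P : pred I) (F : I -> R[i]) :
  cmod (\sum_(i <- r | P i) F i) <= \sum_(i <- r | P i) cmod (F i).
Proof.
elim/big_rec2: _ => [|i y z _ h]; first by rewrite cmod0.
by apply: le_trans (cmodD _ _) _; rewrite lerD2l.
Qed.

Lemma Re_sum (I : Type) (r : seq I) (P : pred I) (F : I -> R[i]) :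
  complex.Re (\sum_(i <- r | P i) F i) = \sum_(i <- r | P i) complex.Re (F i).
Proof. by apply: (big_morph (@complex.Re R)) => // -[a b] [c d]. Qed.

Lemma Im_sum (I : Type) (r : seq I) (P : pred I) (F : I -> R[i]) :
  complex.Im (\sum_(i <- r | P i) F i) = \sum_(i <- r | P i) complex.Im (F i).
Proof. by apply: (big_morph (@complex.Im R)) => // -[a b] [c d]. Qed.

Lemma eta_divn z n :
  ((complex.Re z / n%:R) +i* (complex.Im z / n%:R))%C = z / n%:R.
Proof.
rewrite -(rmorph_nat (real_complex R)) -fmorphV; case: z => a b /=.
by simpc.
Qed.

Definition unit_root n : R[i] :=
  let t := 2 * pi / n%:R in (cos t +i* sin t)%C.

Lemma cis_exp (t : R) n :
  (cos t +i* sin t)%C ^+ n = (cos (t * n%:R) +i* sin (t * n%:R))%C.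
Proof.
elim: n => [|n IH]; first by rewrite mulr0 cos0 sin0.
rewrite exprS IH -natr1 mulrDr mulr1 addrC cosD sinD; simpc.
by congr (_ +i* _)%C; rewrite addrC mulrC [X in _ + X]mulrC.
Qed.

(** If [0 < j < n] and [cos (2 u) = 1] for [u = pi * j / n], then [sin u = 0],
    whereas [0 < u < pi]. *)
Lemma unit_root_prim n : (0 < n)%N -> n.-primitive_root (unit_root n).
Proof.
move=> n0; have n0' : (n%:R : R) != 0 by rewrite pnatr_eq0 -lt0n.
apply/andP; split=> //; apply/forallP => j; rewrite unity_rootE /unit_root.
rewrite cis_exp; have := ltn_ord j; rewrite leq_eqVlt => /predU1P[->|jn].
  by rewrite divfK // mulr_natl cos2pi sin2pi !eqxx.
rewrite (ltn_eqF jn) eqbF_neg; apply/eqP => -[c1 _].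
set t := _ * _ in c1; pose u := pi * (j.+1%:R / n%:R) : R.
have tE : t = u *+ 2 by rewrite /t /u -mulr_natl; field.
have u0 : 0 < u < pi.
  rewrite /u mulr_gt0 ?pi_gt0 ?divr_gt0 ?ltr0n //=.
  by rewrite gtr_pMr ?pi_gt0 // ltr_pdivrMr ?ltr0n // mul1r ltr_nat.
have := sin_gt0_pi u0; have := cos2Dsin2 u.
by move: c1; rewrite tE cos_mulr2n; nra.
Qed.

Lemma cmod_unit_root n : cmod (unit_root n) = 1.
Proof. by rewrite /cmod /= cos2Dsin2 sqrtr1. Qed.

Lemma conjc_unit_root n : (unit_root n)^*%C = (unit_root n)^-1.
Proof.
by rewrite invc_norm cmodE cmod_unit_root expr1n invr1 mul1r.
Qed.

Lemma sum_unit_root n a b : (0 < n)%N ->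
  \sum_(d < n) (unit_root n ^+ a * (unit_root n ^+ b)^*%C) ^+ d =
  if a == b %[mod n] then n%:R else 0.
Proof.
move=> n0; have pr := unit_root_prim n0.
set z := _ * _; have w0 : unit_root n != 0.
  apply: contraTneq (eqxx (cmod (unit_root n))) => {1}->.
  by rewrite cmod_unit_root cmod0 eq_sym oner_eq0.
have zE : z = unit_root n ^+ a / unit_root n ^+ b.
  by rewrite /z conjcX conjc_unit_root exprVn.
have z1 : (z == 1) = (a == b %[mod n]).
  rewrite -(eq_prim_root_expr pr) zE.
  by rewrite -[in LHS](inj_eq (mulIf (expf_neq0 b w0))) divfK ?expf_neq0 // mul1r.
rewrite -z1; case: eqVneq => [->|zn1].
  rewrite (eq_bigr (fun _ => 1)) => [|i _]; last by rewrite expr1n.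
  by rewrite sumr_const card_ord.
have zn : z ^+ n = 1.
  rewrite zE expr_div_n (exprAC _ a) (exprAC _ b) (prim_expr_order pr).
  by rewrite !expr1n divr1.
have := subrX1 z n; rewrite zn subrr => /esym/eqP.
by rewrite mulf_eq0 subr_eq0 (negbTE zn1) /= => /eqP.
Qed.

End ComplexModulus.

(** * Vilenkin functions and the Dirichlet kernel *)

Section Characters.
Variables (R : realType) (m : nat -> nat).
Hypothesis m_ge2 : forall k, (2 <= m k)%N.
Local Notation G := (Gm m).
Local Notation M := (gprod m).
Local Notation point := (@point m).
Local Notation psi := (@psi R m).

Let m_gt0 k : (0 < m k)%N. Proof. exact: ltnW (m_ge2 k). Qed.

Lemma rademacherE k (x : G) : rademacher R k x = unit_root R (m k) ^+ x k.
Proof.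
rewrite /rademacher /unit_root cis_exp.
by rewrite (mulrAC (2 * pi)).
Qed.

(** The digits of [n] beyond the last nonzero one contribute trivial factors, so
    any range containing the nonzero ones may be used. *)
Lemma psi_wide N n (x : G) : (n < M N)%N ->
  psi n x = \prod_(k < N) rademacher R k x ^+ vdigit m n k.
Proof.
pose P N := \prod_(k < N) rademacher R k x ^+ vdigit m n k.
have stable a b : (n < M a)%N -> (a <= b)%N -> P a = P b.
  move=> na /subnKC<-; rewrite /P big_split_ord /= [X in _ * X]big1 ?mulr1 //.
  move=> i _; rewrite vdigit_small //; apply: leq_trans na _.
  by apply: leq_gprod => //; exact: leq_addr.
move=> nN; rewrite /psi -/(P n) -/(P N).
rewrite (stable _ _ (ltn_gprod m_ge2 n) (leq_maxl n N)).
by rewrite (stable _ _ nN (leq_maxr n N)).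
Qed.

Lemma level_psi N n : (n < M N)%N -> level N (psi n).
Proof.
move=> nN x y xy; rewrite !(psi_wide _ nN); apply: eq_bigr => k _.
by rewrite !rademacherE xy.
Qed.

Lemma cmod_psi n x : cmod (psi n x) = 1.
Proof.
rewrite /psi; elim/big_rec: _ => [|k z _ h]; first exact: cmod1.
rewrite cmodM h mulr1 rademacherE -exprM.
by elim: (_ * _)%N => [|j IH]; rewrite ?cmod1 // exprS cmodM IH mulr1 cmod_unit_root.
Qed.

Lemma psiD s a r (x : G) : (M s %| a)%N -> (r < M s)%N ->
  psi (a + r) x = psi a x * psi r x.
Proof.
move=> sa rs; pose N := (a + r)%N.
have NM := ltn_gprod m_ge2 N.
rewrite !(@psi_wide N) ?(leq_ltn_trans _ NM) ?leq_addr ?leq_addl //.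
rewrite -big_split /=; apply: eq_bigr => k _.
by rewrite -exprD (vdigitD m_ge2 _ sa rs).
Qed.

Lemma psi_point0 n : psi n (point 0) = 1.
Proof.
rewrite /psi big1 // => k _; rewrite rademacherE pointE //.
by rewrite vdigit_small ?gprod_gt0 // expr0 expr1n.
Qed.

(** As the [psi k] are characters this is the translate [D_n (x - y)] of the
    Dirichlet kernel; the two-variable form does without the group law. *)
Definition dirichlet n (x y : G) : R[i] :=
  \sum_(k < n) psi k x * (psi k y)^*%C.

Lemma cmod_dirichlet n x y : cmod (dirichlet n x y) <= n%:R.
Proof.
apply: le_trans (cmod_sum _ _ _) _.
rewrite (eq_bigr (fun _ => 1)) => [|k _]; last first.
  by rewrite cmodM cmodJ !cmod_psi mulr1.
by rewrite sumr_const card_ord.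
Qed.

(** The sum factors over the digits of the frequency, and the factor of a
    coordinate in which [x] and [y] differ is a full sum of roots of unity. *)
Lemma dirichlet_block s (x y : G) :
  dirichlet (M s) x y = if `[< vint s x y >] then (M s)%:R else 0.
Proof.
pose F k d := (rademacher R k x * (rademacher R k y)^*%C) ^+ d.
rewrite /dirichlet (eq_bigr (fun i : 'I_(M s) => \prod_(j < s) F j (vdigit m i j))).
  rewrite (sum_prod_vdigit m_ge2).
  have FE j : \sum_(d < m j) F j d = if x j == y j then (m j)%:R else 0.
    rewrite /F !rademacherE sum_unit_root // !modn_small ?coord_lt //.
  case: asboolP => [xy|nxy].
    rewrite /gprod natr_prod; apply: eq_bigr => j _.
    by rewrite FE xy ?eqxx.
  have [j js ne] : exists2 j, (j < s)%N & x j != y j.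
    apply: contrapT => h; apply: nxy => k ks; apply/eqP; apply: contraT => ne.
    by case: h; exists k => //; rewrite eq_sym.
  by rewrite (bigD1 (Ordinal js)) //= FE (negbTE ne) mul0r.
move=> i _; rewrite !(@psi_wide s) // conjc_prod -big_split /=.
by apply: eq_bigr => j _; rewrite /F exprMn conjcX.
Qed.

Lemma dirichlet_mul s q (x y : G) :
  dirichlet (q * M s) x y =
  (\sum_(l < q) psi (l * M s) x * (psi (l * M s) y)^*%C) * dirichlet (M s) x y.
Proof.
rewrite /dirichlet (big_block (fun k => psi k x * (psi k y)^*%C)).
rewrite mulr_suml; apply: eq_bigr => l _; rewrite mulr_sumr.
apply: eq_bigr => r _; rewrite !(@psiD s) ?dvdn_mull // conjcM.
by rewrite mulrACA.
Qed.

(** Blocks of [M s] consecutive characters sum to zero off the diagonal atoms,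
    so the kernel is supported there as soon as [M s] divides [n]. *)
Lemma dirichlet_eq0 s n (x y : G) :
  (M s %| n)%N -> ~ vint s x y -> dirichlet n x y = 0.
Proof.
move=> /dvdnP[q ->] nxy; rewrite dirichlet_mul dirichlet_block.
by case: asboolP => // _; rewrite mulr0.
Qed.

(** Dual to [dirichlet_block]: now the sum factors over the coordinates of the
    point. *)
Lemma psi_orthonormal N k i : (k < M N)%N -> (i < M N)%N ->
  \sum_(y < M N) psi k (point y) * (psi i (point y))^*%C =
  if k == i then (M N)%:R else 0.
Proof.
move=> kN iN.
pose F j d := (unit_root R (m j) ^+ vdigit m k j *
   (unit_root R (m j) ^+ vdigit m i j)^*%C) ^+ d.
rewrite (eq_bigr (fun y : 'I_(M N) => \prod_(j < N) F j (vdigit m y j))).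
  rewrite (sum_prod_vdigit m_ge2).
  have FE j : \sum_(d < m j) F j d =
      if vdigit m k j == vdigit m i j then (m j)%:R else 0.
    by rewrite /F sum_unit_root // !modn_small ?vdigit_lt.
  case: eqVneq => [ki|ne].
    by rewrite /gprod natr_prod; apply: eq_bigr => j _; rewrite FE ki eqxx.
  have [j jN jne] : exists2 j, (j < N)%N & vdigit m k j != vdigit m i j.
    apply: contrapT => h; case/eqP: ne.
    rewrite -(modn_small kN) -(modn_small iN); apply/eq_vdigitP => // j jN.
    by apply/eqP; apply: contraT => ne; case: h; exists j.
  by rewrite (bigD1 (Ordinal jN)) //= FE (negbTE jne) mul0r.
move=> y _; rewrite !(@psi_wide N) // conjc_prod -big_split /=.
apply: eq_bigr => j _; rewrite !rademacherE !pointE // /F exprMn !conjcX.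
by rewrite -!exprM mulnC [X in _ * _ ^+ X]mulnC.
Qed.

End Characters.

(** * Fourier coefficients of martingales *)

Section FourierCoefficients.
Variables (R : realType) (m : nat -> nat).
Hypothesis m_ge2 : forall k, (2 <= m k)%N.
Local Notation G := (Gm m).
Local Notation M := (gprod m).
Local Notation point := (@point m).
Local Notation psi := (@psi R m).
Variable mu : probability G R.
Hypothesis hmu : is_product_measure mu.

Let M_gt0 k : (0 < M k)%N.
Proof. by apply: gprod_gt0 => j; exact: m_ge2. Qed.

Lemma level_Re n (f : G -> R[i]) : level n f ->
  level n (fun x => complex.Re (f x)).
Proof. by move=> lf x y xy; rewrite (lf _ _ xy). Qed.

Lemma level_Im n (f : G -> R[i]) : level n f ->
  level n (fun x => complex.Im (f x)).
Proof. by move=> lf x y xy; rewrite (lf _ _ xy). Qed.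

Lemma level_cintegral n (f : G -> R[i]) (A : set G) :
  level n f -> level n A -> cintegral mu A f =
    (\sum_(i < M n | point i \in A) f (point i)) / (M n)%:R.
Proof.
move=> lf lA; rewrite /cintegral.
rewrite (level_Rintegral m_ge2 hmu (level_Re lf) lA).
rewrite (level_Rintegral m_ge2 hmu (level_Im lf) lA).
by rewrite -Re_sum -Im_sum eta_divn.
Qed.

Lemma level_vint n (x : G) : level n (vint n x).
Proof.
move=> y z yz; apply/propext; split=> h; first exact: vint_trans h yz.
by apply: vint_trans h _; exact: vint_sym.
Qed.

Lemma vint_pointP n x i :
  (point i \in vint n (point x)) = (i == x %[mod M n]).
Proof.
apply/idP/idP => [|/eqP h]; rewrite inE.
  by move=> /(vint_point m_ge2) h; apply/eqP.
by apply/(vint_point m_ge2).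
Qed.

Variable f : nat -> G -> R[i].
Hypothesis mf : martingale mu f.

Lemma martingale_level n : level n (f n).
Proof. by apply/(vmeasurableP m_ge2); case: mf. Qed.

Lemma martingale_avg n k x : (n <= k)%N -> (x < M n)%N ->
  (\sum_(z < M k | z == x %[mod M n]) f k (point z)) / (M k)%:R =
  f n (point x) / (M n)%:R.
Proof.
move=> nk xn; case: mf => _ _ /(_ n k (vint n (point x)) nk).
have lA := @level_vint n (point x).
move=> /(_ (level_vfiltration m_ge2 lA)).
rewrite (level_cintegral (@martingale_level k) (level_le nk lA)).
rewrite (level_cintegral (@martingale_level n) lA).
have E j (F : nat -> R[i]) : \sum_(z < M j | point z \in vint n (point x)) F z =
    \sum_(z < M j | z == x %[mod M n]) F z.
  by apply: eq_bigl => z; exact: vint_pointP.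
rewrite (E k (fun z => f k (point z))) => ->.
rewrite (E n (fun z => f n (point z))); congr (_ / _).
rewrite (big_pred1 (Ordinal xn)) // => i.
by rewrite !modn_small.
Qed.

(** The sequence defining the coefficient is constant from [n] on: [psi i] is
    constant on the atoms of level [n], on which every later [f k] has the same
    mean as [f n]. *)
Lemma vcoefE n i : (i < M n)%N -> vcoef mu f i =
  (\sum_(y < M n) f n (point y) * (psi i (point y))^*%C) / (M n)%:R.
Proof.
move=> iM; rewrite /vcoef; apply: (@lim_near_cst R[i]^o); first exact: norm_hausdorff.
exists n => //= k nk.
have lk j : (n <= j)%N -> level j (fun x => f j x * (psi i x)^*%C).
  move=> nj x y xy; rewrite (@martingale_level j _ _ xy).
  by rewrite (level_psi R m_ge2 iM (vint_le nj xy)).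
rewrite (level_cintegral (lk k nk)) //.
rewrite (partition_big (fun z : 'I_(M k) => Ordinal (ltn_pmod z (M_gt0 n))) predT) //=.
rewrite !mulr_suml; apply: eq_bigr => x _.
rewrite mulrAC -(martingale_avg nk (ltn_ord x)) mulrAC; congr (_ / _).
rewrite mulr_suml; apply: eq_big => [z|z /andP[_ /eqP <-]].
  by rewrite in_setT -val_eqE /= (modn_small (ltn_ord x)).
congr (_ * (_)^*%C); apply: (level_psi R m_ge2 iM); apply/(vint_point m_ge2).
by rewrite /= modn_mod.
Qed.

Lemma vsumE a n x : (a <= M n)%N -> vsum mu a f x =
  (\sum_(y < M n) f n (point y) * dirichlet R a x (point y)) / (M n)%:R.
Proof.
move=> aM; rewrite /vsum.
rewrite (eq_bigr (fun k : 'I_a => \sum_(y < M n)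
   f n (point y) * (psi k x * (psi k (point y))^*%C) / (M n)%:R)).
  rewrite exchange_big /= mulr_suml; apply: eq_bigr => y _.
  by rewrite /dirichlet mulr_sumr mulr_suml.
move=> k _; rewrite (@vcoefE n); last exact: leq_trans (ltn_ord k) aM.
rewrite !mulr_suml; apply: eq_bigr => y _.
by rewrite mulrAC -(mulrA _ _ (psi k x)) [_ * psi k x]mulrC.
Qed.

End FourierCoefficients.

(** * Truncated maximal functions *)

Section PowerMonotone.
Variable R : realType.

Lemma ler_powR_base (r x y : R) : 0 <= r -> 0 <= x -> x <= y ->
  x `^ r <= y `^ r.
Proof.
move=> r0 x0 xy; apply: ge0_ler_powR => //; rewrite nnegrE //.
exact: le_trans xy.
Qed.

Lemma lee_poweR_base (r : R) (x y : \bar R) : 0 <= r -> (0 <= x)%E ->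
  (x <= y)%E -> (x `^ r <= y `^ r)%E.
Proof.
move=> r0 x0 xy; apply: gt0_ler_poweR => //; rewrite in_itv /= leey andbT //.
exact: le_trans xy.
Qed.

Lemma powR_invK (r x : R) : r != 0 -> 0 <= x -> (x `^ r^-1) `^ r = x.
Proof. by move=> r0 x0; rewrite -powRrM mulVf // powRr1. Qed.

Lemma powR_Kinv (r x : R) : r != 0 -> 0 <= x -> (x `^ r) `^ r^-1 = x.
Proof. by move=> r0 x0; rewrite -powRrM mulfV // powRr1. Qed.

Lemma powR_le_inv (r x y : R) : 0 < r -> 0 <= x -> x `^ r <= y -> x <= y `^ r^-1.
Proof.
move=> r0 x0 xy; rewrite -(@powR_Kinv r x) ?gt_eqF //.
by apply: ler_powR_base => //; rewrite ?powR_ge0 ?invr_ge0 ?ltW.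
Qed.

End PowerMonotone.

Lemma card_residue q n x : (0 < n)%N ->
  #|[pred y : 'I_(q * n) | y == x %[mod n]]| = q.
Proof.
move=> n0; rewrite -sum1_card big_mkcond /=.
rewrite (big_block (fun y => if y == x %[mod n] then 1 else 0)%N).
rewrite (eq_bigr (fun _ => 1%N)) => [|l _]; first by rewrite sum_nat_const card_ord muln1.
rewrite -big_mkcond /= (big_pred1 (Ordinal (ltn_pmod x n0))) // => r.
by rewrite /= modnMDl -val_eqE /= (modn_small (ltn_ord r)).
Qed.

Section MaximalFunction.
Variables (R : realType) (m : nat -> nat).
Hypothesis m_ge2 : forall k, (2 <= m k)%N.
Local Notation G := (Gm m).
Variable mu : probability G R.

Definition max_upto (g : nat -> G -> R[i]) n (x : G) : R :=
  \big[Num.max/0]_(k < n) cmod (g k x).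

Lemma le_max_upto (g : nat -> G -> R[i]) k n x :
  (k < n)%N -> cmod (g k x) <= max_upto g n x.
Proof. by move=> kn; exact: (le_bigmax _ _ (Ordinal kn)). Qed.

Lemma max_upto_ge0 (g : nat -> G -> R[i]) n x : 0 <= max_upto g n x.
Proof. by apply: bigmax_ge_id. Qed.

Lemma max_upto_le (g : nat -> G -> R[i]) n x c :
  0 <= c -> (forall k, (k < n)%N -> cmod (g k x) <= c) -> max_upto g n x <= c.
Proof. by move=> c0 h; apply: bigmax_le => // k _; exact: h. Qed.

Lemma max_upto_mono (g : nat -> G -> R[i]) k n x : (k <= n)%N ->
  max_upto g k x <= max_upto g n x.
Proof.
move=> kn; apply: max_upto_le; first exact: max_upto_ge0.
by move=> j jk; apply: le_max_upto; exact: leq_trans jk kn.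
Qed.

Lemma level_max_upto (g : nat -> G -> R[i]) L n :
  (forall k, (k < n)%N -> level L (g k)) -> level L (max_upto g n).
Proof.
by move=> lg x y xy; apply: eq_bigr => k _; rewrite (lg _ (ltn_ord k) _ _ xy).
Qed.

Lemma max_upto_le_sup_mod (g : nat -> G -> R[i]) n x :
  ((max_upto g n x)%:E <= sup_mod g x)%E.
Proof.
rewrite /max_upto; elim/big_ind: _ => [|a b ha hb|k _].
- apply: (@le_trans _ _ (cmod (g 0%N x))%:E); first by rewrite lee_fin cmod_ge0.
  by apply: ereal_sup_ubound; exists 0%N.
- by rewrite /Num.max; case: ifP.
- by apply: ereal_sup_ubound; exists k.
Qed.

Lemma sup_mod_ge0 (g : nat -> G -> R[i]) x : (0 <= sup_mod g x)%E.
Proof.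
apply: le_trans (max_upto_le_sup_mod g 0 x).
by rewrite lee_fin max_upto_ge0.
Qed.

Variables (g : nat -> G -> R[i]) (l : nat -> nat).
Hypothesis lg : forall k, level (l k) (g k).

Lemma measurable_sup_mod : measurable_fun setT (sup_mod g).
Proof.
rewrite [X in measurable_fun _ X](_ : _ =
    fun x => esups (fun k => (cmod (g k x))%:E) 0).
  apply: measurable_fun_esups => k.
  apply: (level_measurable m_ge2 (n := l k)) => // x y xy.
  by rewrite (lg xy).
apply/funext => x; rewrite /sup_mod /esups /=; congr ereal_sup.
by apply/seteqP; split=> [_ [k _ <-]|_ [k _ <-]]; exists k.
Qed.

Lemma measurable_sup_mod_poweR p :
  measurable_fun setT (fun x => `|sup_mod g x| `^ p)%E.
Proof.
apply: (measurableT_comp (measurable_poweR p)).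
exact: (measurableT_comp _ measurable_sup_mod).
Qed.

Lemma level_max_upto_all n : exists L, level L (max_upto g n).
Proof.
exists (\max_(k < n) l k)%N; apply: level_max_upto => k kn.
by apply: level_le (lg (k:=k)); exact: (leq_bigmax (Ordinal kn)).
Qed.

Lemma measurable_max_upto_powR n p :
  measurable_fun setT (fun x => (max_upto g n x `^ p)%:E).
Proof.
have [L lL] := level_max_upto_all n.
by apply: (level_measurable m_ge2 (n := L)) => // x y xy; rewrite (lL _ _ xy).
Qed.

(** Monotone convergence along the truncated maxima. *)
Lemma integral_sup_mod_le p (c : \bar R) : 0 < p ->
  (forall n, (\int[mu]_x (max_upto g n x `^ p)%:E <= c)%E) ->
  (\int[mu]_x (`|sup_mod g x| `^ p) <= c)%E.
Proof.
move=> p0 h.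
pose u n x := (max_upto g n x `^ p)%:E.
have u_ndecr x : {homo u^~ x : a b / (a <= b)%N >-> (a <= b)%E}.
  move=> a b ab; rewrite lee_fin; apply: ler_powR_base.
  - exact: ltW.
  - exact: max_upto_ge0.
  - exact: max_upto_mono.
have ucvg x := ereal_nondecreasing_cvgn (@u_ndecr x).
apply: (@le_trans _ _ (\int[mu]_x (limn (u^~ x))))%E.
  apply: ge0_le_integral => //.
  - by move=> x _; exact: poweR_ge0.
  - exact: measurable_sup_mod_poweR.
  - apply: (emeasurable_fun_cvg u) => [n|x _].
      exact: measurable_max_upto_powR.
    by apply: ereal_nondecreasing_is_cvgn; exact: u_ndecr.
  move=> x _; rewrite gee0_abs ?sup_mod_ge0 // (cvg_lim _ (ucvg x)) //.
  set T := ereal_sup _.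
  have T0 : (0 <= T)%E.
    apply: (@le_trans _ _ (u 0%N x)); first by rewrite lee_fin powR_ge0.
    by apply: ereal_sup_ubound; exists 0%N.
  have -> : T = ((T `^ p^-1) `^ p)%E.
    by rewrite -poweRrM mulVf ?gt_eqF // poweRe1.
  apply: lee_poweR_base; [exact: ltW|exact: sup_mod_ge0|].
  apply: ge_ereal_sup => _ [k _ <-].
  have -> : (cmod (g k x))%:E = (((cmod (g k x) `^ p)%:E) `^ p^-1)%E.
    by rewrite poweR_EFin powR_Kinv ?gt_eqF // cmod_ge0.
  apply: lee_poweR_base; [by rewrite invr_ge0 ltW|by rewrite lee_fin powR_ge0|].
  apply: (@le_trans _ _ (u k.+1 x)); last by apply: ereal_sup_ubound; exists k.+1.
  rewrite lee_fin; apply: ler_powR_base; [exact: ltW|exact: cmod_ge0|].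
  exact: le_max_upto.
rewrite monotone_convergence //.
- apply: lime_le; last exact: nearW.
  apply: ereal_nondecreasing_is_cvgn => a b ab.
  apply: ge0_le_integral => //.
  + by move=> x _; rewrite lee_fin powR_ge0.
  + exact: measurable_max_upto_powR.
  + exact: measurable_max_upto_powR.
  + by move=> x _; exact: u_ndecr.
- by move=> n; exact: measurable_max_upto_powR.
- by move=> n x _; rewrite lee_fin powR_ge0.
Qed.

Lemma integral_max_upto_le n p : 0 <= p ->
  (\int[mu]_x (max_upto g n x `^ p)%:E <=
   \int[mu]_x (`|sup_mod g x| `^ p))%E.
Proof.
move=> p0; apply: ge0_le_integral => //.
- by move=> x _; rewrite lee_fin powR_ge0.
- exact: measurable_max_upto_powR.
- exact: measurable_sup_mod_poweR.
move=> x _; rewrite -poweR_EFin; apply: lee_poweR_base => //.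
  by rewrite lee_fin max_upto_ge0.
by rewrite gee0_abs ?sup_mod_ge0 // max_upto_le_sup_mod.
Qed.

End MaximalFunction.

(** * The maximal operator of partial sums with bounded rho *)

Section MaximalPartialSums.
Variables (R : realType) (m : nat -> nat).
Hypothesis m_ge2 : forall k, (2 <= m k)%N.
Variable B : nat.
Hypothesis m_leB : forall k, (m k <= B)%N.
Local Notation G := (Gm m).
Local Notation M := (gprod m).
Local Notation point := (@point m).
Variable mu : probability G R.
Hypothesis hmu : is_product_measure mu.
Variables (q : R) (kappa : nat).
Hypothesis q_gt0 : 0 < q.

Let M_gt0 k : (0 < M k)%N.
Proof. by apply: gprod_gt0 => j; exact: m_ge2. Qed.

(** Bounds the number [M_n / M_s] of atoms of level [n] in one of level [s] when
    [n <= s + kappa + 1]. *)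
Let D : R := (B ^ kappa.+1)%:R.

Let D_gt0 : 0 < D.
Proof.
by rewrite ltr0n expn_gt0 (leq_trans _ (m_leB 0)) // (ltn_trans _ (m_ge2 0)).
Qed.

Definition residue_rel L (s : nat) : rel 'I_(M L) :=
  fun i j => i == j %[mod M s].

Lemma residue_equiv L s : equivalence_rel (@residue_rel L s).
Proof.
move=> x y z; split; first exact: eqxx.
by rewrite /residue_rel => /eqP->.
Qed.

Lemma residue_decr L s (x y : 'I_(M L)) :
  residue_rel s.+1 x y -> residue_rel s x y.
Proof.
move=> /eqP h; apply/eqP; apply/(eq_vdigitP m_ge2) => k ks.
by move/(eq_vdigitP m_ge2): h => -> //; exact: ltnW.
Qed.

Lemma residue_le L s n (x y : 'I_(M L)) : (s <= n)%N ->
  residue_rel n x y -> residue_rel s x y.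
Proof.
move=> sn /eqP h; apply/eqP; apply/(eq_vdigitP m_ge2) => k ks.
by move/(eq_vdigitP m_ge2): h => -> //; exact: leq_trans ks sn.
Qed.

Lemma card_residue_rel L s (x : 'I_(M L)) : (s <= L)%N ->
  (#|residue_rel s x|%:R : R) = (M L)%:R / (M s)%:R.
Proof.
move=> sL; have /dvdnP[c cE] := dvdn_gprod m sL.
have -> : #|residue_rel s x| = c.
  rewrite -[RHS](card_residue c x (M_gt0 s)) -cE.
  by apply: eq_card => y; rewrite inE /in_mem /= /residue_rel eq_sym.
by rewrite cE natrM mulfK // pnatr_eq0 -lt0n.
Qed.

Variable f : nat -> G -> R[i].
Hypothesis mf : martingale mu f.

Let Z L (z : 'I_(M L)) : R := max_upto f L.+1 (point z) `^ q.

Let Z_ge0 L z : 0 <= @Z L z. Proof. exact: powR_ge0. Qed.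

(** [f_n] is constant on an atom of level [n], where it is dominated by every
    value of the maximal function, hence by its average; that atom fills a
    proportion at least [1 / D] of the surrounding atom of level [s]. *)
Lemma martingale_le_avg L s n (x : 'I_(M L)) (y : nat) :
  (s <= n)%N -> (n <= s + kappa.+1)%N -> (n <= L)%N ->
  (y < M n)%N -> y = x %[mod M s] ->
  cmod (f n (point y)) `^ q <= D * class_avg (@residue_rel L) (@Z L) s x.
Proof.
move=> sn ns nL yM yx.
pose y' : 'I_(M L) := Ordinal (leq_trans yM (leq_gprod m_ge2 nL)).
have lower : cmod (f n (point y)) `^ q * #|residue_rel n y'|%:R <=
    \sum_(z | residue_rel s x z) Z z.
  apply: (@le_trans _ _ (\sum_(z | residue_rel n y' z) Z z)).
    rewrite mulr_natr -sumr_const; apply: ler_sum => z yz.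
    apply: ler_powR_base; [exact: ltW | exact: cmod_ge0 |].
    have -> : f n (point y) = f n (point z).
      by apply: (martingale_level m_ge2 mf); apply/(vint_point m_ge2)/eqP.
    by apply: le_max_upto; rewrite ltnS.
  rewrite big_mkcond [leRHS]big_mkcond; apply: ler_sum => z _.
  case: ifP => yz; last by case: ifP.
  suff -> : residue_rel s x z by [].
  have := residue_le sn yz; rewrite /residue_rel /= => /eqP <-.
  by rewrite yx.
have dpos k : 0 < (M k)%:R :> R by rewrite ltr0n.
rewrite /class_avg card_residue_rel ?(leq_trans sn) //.
rewrite card_residue_rel // in lower.
have nsD : (M n)%:R <= D * (M s)%:R.
  rewrite -natrM ler_nat; apply: leq_trans (leq_gprod m_ge2 ns) _.
  exact: leq_gprod_addn.
set S := \sum_(_ | _) _ in lower *; set c := _ `^ q in lower *.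
have S0 : 0 <= S by exact: sumr_ge0.
have c1 : c <= S * (M n)%:R / (M L)%:R.
  by rewrite ler_pdivlMr // -ler_pdivrMr // -mulrA.
apply: le_trans c1 _; rewrite invf_div !mulrA ler_pM2r ?invr_gt0 //.
by rewrite -mulrA mulrCA ler_wpM2l.
Qed.

(** The factor [D ^ q] counts the atoms met by the kernel, the other [D] comes
    from [martingale_le_avg]. *)
Let C : R := D `^ q * D.

(** The kernel of [S_a f] lives on the atom of level [<a>] around [x] and is at
    most [M_n] for [n = |a| + 1]; hence [|S_a f (x)|] is at most the sum of
    [|f_n|] over the boundedly many atoms of level [n] inside that atom. *)

Lemma vsum_le_avg a L (x : 'I_(M L)) :
  (0 < a)%N -> (vrho m a <= kappa)%N -> (vhigh m a < L)%N ->
  cmod (vsum mu a f (point x)) `^ q <=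
  C * max_class_avg (@residue_rel L) (@Z L) L x.
Proof.
move=> a0 rhoa aL; set s := vlow m a; set n := (vhigh m a).+1.
have hl := vlow_le_vhigh m_ge2 a0.
have sn : (s <= n)%N by apply: leq_trans hl _.
have ns : (n <= s + kappa.+1)%N.
  by rewrite addnS ltnS -leq_subLR.
set avg := class_avg (@residue_rel L) (@Z L) s x.
have avg0 : 0 <= avg by exact: class_avg_ge0.
have aM := ltn_gprod_vhigh m_ge2 a; rewrite -/n in aM.
have Mn0 : 0 < (M n)%:R :> R by rewrite ltr0n.
have bound : cmod (vsum mu a f (point x)) <= D * (D * avg) `^ q^-1.
  rewrite (vsumE m_ge2 hmu mf _ (ltnW aM)) cmodM.
  have -> : cmod ((M n)%:R^-1 : R[i]) = (M n)%:R^-1.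
    rewrite -[LHS]/(ComplexField.Normc.normc _) ComplexField.Normc.normcV.
    by rewrite -/(cmod _) cmod_nat.
  rewrite ler_pdivrMr //; apply: le_trans (cmod_sum _ _ _) _.
  rewrite (bigID (fun y : 'I_(M n) => y == x %[mod M s])) /= addrC big1 ?add0r.
    apply: (@le_trans _ _ (\sum_(y < M n | y == x %[mod M s])
        (D * avg) `^ q^-1 * (M n)%:R)).
      apply: ler_sum => y /eqP yx; rewrite cmodM ler_pM ?cmod_ge0 //.
        apply: powR_le_inv; rewrite ?cmod_ge0 //.
        exact: martingale_le_avg.
      apply: (le_trans (cmod_dirichlet _ _ _ _)).
      by rewrite ler_nat ltnW.
    rewrite sumr_const -[leLHS]mulr_natl mulrA ler_wpM2r ?(ltW Mn0) //.
    rewrite ler_wpM2r ?powR_ge0 //.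
    have /dvdnP[c cE] := dvdn_gprod m sn.
    rewrite cE (@eq_card _ _ [pred y : 'I_(c * M s) | y == x %[mod M s]]) //.
    rewrite card_residue // ler_nat -(leq_pmul2r (M_gt0 s)) -cE.
    apply: leq_trans (leq_gprod m_ge2 ns) _; exact: leq_gprod_addn.
  move=> y yx; rewrite (dirichlet_eq0 R m_ge2 (vlowP m_ge2 a0).2) ?mulr0 ?cmod0 //.
  by move=> /(vint_point m_ge2) e; case/eqP: yx.
apply: le_trans (ler_powR_base (ltW q_gt0) (cmod_ge0 _) bound) _.
have Davg0 : 0 <= D * avg by rewrite mulr_ge0 // ltW.
rewrite powRM ?powR_ge0 ?(ltW D_gt0) // powR_invK ?gt_eqF //.
rewrite mulrA ler_wpM2l // ?mulr_ge0 ?powR_ge0 ?(ltW D_gt0) //.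
by apply: class_avg_le_max; exact: leq_trans sn aL.
Qed.

Variable alpha : nat -> nat.
Hypothesis alpha_gt0 : forall k, (0 < alpha k)%N.
Hypothesis rho_alpha : forall k, (vrho m (alpha k) <= kappa)%N.

(** Doob's inequality in L^2 for the power [q] of the truncated maximal function
    is an L^p bound with [p = q * 2]; this is why the exponent is halved. *)
Lemma max_vsum_finite n L : (forall k, (k < n)%N -> (vhigh m (alpha k) < L)%N) ->
  \sum_(x < M L) max_upto (fun k => vsum mu (alpha k) f) n (point x) `^ (q * 2) <=
  4 * C ^+ 2 * \sum_(x < M L) max_upto f L.+1 (point x) `^ (q * 2).
Proof.
move=> hL.
have C0 : 0 <= C by rewrite mulr_ge0 ?powR_ge0 // ltW.
have sqE (g : nat -> G -> R[i]) k x :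
    max_upto g k x `^ (q * 2) = (max_upto g k x `^ q) ^+ 2.
  by rewrite powRrM -powR_mulrn ?powR_ge0.
under eq_bigr do rewrite sqE.
under [X in _ <= _ * X]eq_bigr do rewrite sqE.
apply: (@le_trans _ _ (\sum_(x < M L)
    C ^+ 2 * max_class_avg (@residue_rel L) (@Z L) L x ^+ 2)).
  apply: ler_sum => x _; rewrite -exprMn ler_sqr ?nnegrE ?powR_ge0 //; last first.
    by rewrite mulr_ge0 // max_class_avg_ge0.
  have T0 : 0 <= C * max_class_avg (@residue_rel L) (@Z L) L x.
    by rewrite mulr_ge0 // max_class_avg_ge0.
  rewrite -[leRHS](@powR_invK _ q) ?gt_eqF //.
  apply: ler_powR_base; [exact: ltW | exact: max_upto_ge0 |].
  apply: max_upto_le => [|k kn]; first exact: powR_ge0.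
  apply: powR_le_inv; rewrite ?cmod_ge0 //.
  by apply: vsum_le_avg; rewrite ?hL.
rewrite -mulr_sumr -[leRHS]mulrA [leRHS]mulrCA ler_wpM2l ?exprn_ge0 //.
apply: doob_max_class_avg => //; first exact: residue_equiv.
exact: residue_decr.
Qed.

Lemma level_vsum a L : (a <= M L)%N -> level L (vsum mu a f).
Proof.
move=> aL x y xy; apply: eq_bigr => k _.
by rewrite (level_psi R m_ge2 (leq_trans (ltn_ord k) aL) xy).
Qed.

Lemma Lnorm_max_vsum :
  (Lnorm mu (q * 2)%:E (sup_mod (fun k => vsum mu (alpha k) f)) <=
   ((4 * C ^+ 2) `^ (q * 2)^-1)%:E * hardy_norm mu (q * 2) f)%E.
Proof.
set p := q * 2; have p0 : 0 < p by rewrite mulr_gt0.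
have K0 : 0 <= 4 * C ^+ 2 by rewrite mulr_ge0 ?sqr_ge0.
pose g k := vsum mu (alpha k) f.
have lgk k L : (vhigh m (alpha k) < L)%N -> level L (g k).
  move=> kL; apply: level_vsum; apply: ltnW.
  apply: leq_trans (ltn_gprod_vhigh m_ge2 _) _; exact: leq_gprod.
have lg k : level (vhigh m (alpha k)).+1 (g k) by exact: lgk.
have lf k : level k (f k) by exact: (martingale_level m_ge2 mf).
rewrite /hardy_norm unlock /Lnorm -poweR_EFin -poweRM; last 2 first.
- by rewrite lee_fin.
- by apply: integral_ge0 => x _; exact: poweR_ge0.
apply: lee_poweR_base; first by rewrite invr_ge0 ltW.
  by apply: integral_ge0 => x _; exact: poweR_ge0.
apply: (integral_sup_mod_le m_ge2 lg) => // n.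
pose L := (\max_(k < n) (vhigh m (alpha k)).+1)%N.
have kL k : (k < n)%N -> (vhigh m (alpha k) < L)%N.
  by move=> kn; exact: (leq_bigmax (Ordinal kn)).
apply: (@le_trans _ _ ((4 * C ^+ 2)%:E *
    \int[mu]_x (max_upto f L.+1 x `^ p)%:E)%E); last first.
  rewrite lee_wpmul2l ?lee_fin //.
  by apply: (integral_max_upto_le m_ge2 mu lf); exact: ltW.
have lev (u : nat -> G -> R[i]) k : level L (max_upto u k) ->
    level L (fun x => max_upto u k x `^ p).
  by move=> lu x y xy; rewrite (lu _ _ xy).
have lg' : level L (max_upto g n).
  by apply: level_max_upto => k kn; exact: lgk (kL k kn).
rewrite (level_integral m_ge2 hmu (lev _ _ lg')).
have lf' : level L (max_upto f L.+1).
  by apply: level_max_upto => k kL'; apply: level_le (lf k).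
rewrite (level_integral m_ge2 hmu (lev _ _ lf')) -EFinM lee_fin.
by rewrite mulrA ler_wpM2r ?invr_ge0 ?ler0n // max_vsum_finite.
Qed.

End MaximalPartialSums.

(** * Auxiliary estimates for the counterexample *)

Section PowerSums.
Variable R : realType.

(** Subadditivity of [x |-> x ^ p] for [p <= 1]: [t <= t ^ p] on [0, 1]. *)
Lemma powRD_le (p a b : R) : 0 < p <= 1 -> 0 <= a -> 0 <= b ->
  (a + b) `^ p <= a `^ p + b `^ p.
Proof.
move=> /andP[p0 p1] a0 b0; have [ab0|ab0] := eqVneq (a + b) 0.
  by rewrite ab0 powR0 ?gt_eqF // addr_ge0 ?powR_ge0.
have ab : 0 < a + b by rewrite lt_def ab0 addr_ge0.
have part z : 0 <= z -> z <= a + b -> z / (a + b) * (a + b) `^ p <= z `^ p.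
  move=> z0 zab; have [->|zn0] := eqVneq z 0; first by rewrite !mul0r powR_ge0.
  have zpos : 0 < z by rewrite lt_def zn0.
  have -> : z `^ p = (z / (a + b)) `^ p * (a + b) `^ p.
    by rewrite -powRM ?divr_ge0 ?(ltW ab) // divfK.
  rewrite ler_wpM2r ?powR_ge0 // -[leLHS]powRr1 ?divr_ge0 ?(ltW ab) //.
  apply: ger_powR => //.
  by rewrite divr_gt0 //= ler_pdivrMr // mul1r.
have := lerD (part a a0 _) (part b b0 _).
rewrite -mulrDl -mulrDl mulfV // mul1r; apply.
  by rewrite lerDl.
by rewrite lerDr.
Qed.

Lemma powR_sum_le (p : R) (I : Type) (r : seq I) (P : pred I) (F : I -> R) :
  0 < p <= 1 -> (forall i, 0 <= F i) ->
  (\sum_(i <- r | P i) F i) `^ p <= \sum_(i <- r | P i) F i `^ p.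
Proof.
move=> pp F0; have p0 : 0 < p by case/andP: pp.
suff : 0 <= \sum_(i <- r | P i) F i /\
    (\sum_(i <- r | P i) F i) `^ p <= \sum_(i <- r | P i) F i `^ p by case.
elim/big_rec2: _ => [|i y z _ [z0 h]]; first by rewrite powR0 ?gt_eqF.
split; first by rewrite addr_ge0.
by apply: le_trans (powRD_le pp _ _) _; rewrite // lerD2l.
Qed.

(** Summed over all [u], the geometric sums give [n], of which [u = 0] accounts
    for [d < n] only; so they cannot all be small for [u <> 0]. *)
Lemma unit_root_sum_lower n d : (0 < d < n)%N ->
  exists u, [/\ (0 < u)%N, (u < n)%N &
    1 <= n%:R * cmod (\sum_(l < d) (unit_root R n ^+ u) ^+ l)].
Proof.
move=> /andP[d0 dn]; have n0 : (0 < n)%N by exact: ltn_trans dn.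
pose K u := \sum_(l < d) (unit_root R n ^+ u) ^+ l.
have sumK : \sum_(u < n) K u = n%:R.
  rewrite /K exchange_big /= (bigD1 (Ordinal d0)) //= [X in _ + X]big1 ?addr0.
    rewrite (eq_bigr (fun _ => 1)) ?sumr_const ?card_ord // => u _; rewrite ?expr0.
  move=> l l0; have := @sum_unit_root R n l 0 n0.
  rewrite expr0 conjc1 modn_small ?(ltn_trans (ltn_ord l)) // mod0n.
  rewrite ifF; last by apply: contra_neqF l0 => /eqP l0; exact: val_inj.
  move=> {2}<-; apply: eq_bigr => u _.
  by rewrite mulr1 exprAC.
apply: contrapT => none.
have small (u : 'I_n) : (u : nat) != 0%N -> n%:R * cmod (K u) <= 1.
  move=> u0; rewrite leNgt; apply/negP => h; apply: none; exists u.
  by split; rewrite ?lt0n //; exact: ltW.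
have n0' : 0 < n%:R :> R by rewrite ltr0n.
move: sumK; rewrite (bigD1 (Ordinal n0)) //=.
rewrite {1}/K (eq_bigr (fun _ => 1)) => [|l _]; last by rewrite expr0 expr1n.
rewrite sumr_const card_ord => sumK.
have rest : \sum_(u < n | u != Ordinal n0) K u = (n - d)%:R.
  by rewrite natrB 1?ltnW // -sumK addrAC subrr add0r.
have n1 : (1 < n)%N by exact: leq_ltn_trans d0 dn.
have : n%:R * cmod (\sum_(u < n | u != Ordinal n0) K u) < n%:R.
  apply: (@le_lt_trans _ _ (\sum_(u < n | u != Ordinal n0) n%:R * cmod (K u))).
    by rewrite -mulr_sumr ler_pM2l // cmod_sum.
  apply: (@le_lt_trans _ _ (\sum_(u < n | u != Ordinal n0) 1)).
    by apply: ler_sum => u u0; apply: small.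
  rewrite sumr_const ltr_nat (@eq_card _ _ (predC1 (Ordinal n0))) //.
  by rewrite cardC1 card_ord ltn_predL.
by rewrite rest cmod_nat gtr_pMr // ltrn1 ltnS leqn0 subn_eq0 leqNgt dn.
Qed.

End PowerSums.

(** * Martingales built from Dirichlet kernels *)

Section LacunaryMartingale.
Variables (R : realType) (m : nat -> nat).
Hypothesis m_ge2 : forall k, (2 <= m k)%N.
Variable B : nat.
Hypothesis m_leB : forall k, (m k <= B)%N.
Local Notation G := (Gm m).
Local Notation M := (gprod m).
Local Notation point := (@point m).
Local Notation psi := (@psi R m).
Variable mu : probability G R.
Hypothesis hmu : is_product_measure mu.

Let M_gt0 k : (0 < M k)%N.
Proof. by apply: gprod_gt0 => j; exact: m_ge2. Qed.

Let MR_gt0 k : 0 < (M k)%:R :> R. Proof. by rewrite ltr0n. Qed.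

(** The Dirichlet kernel of order [M_j] in closed form. *)
Definition peak j (x : G) : R := if `[< vint j x (point 0) >] then (M j)%:R else 0.

Lemma level_peak j : level j (peak j).
Proof.
move=> x y xy; rewrite /peak.
suff -> : `[< vint j x (point 0) >] = `[< vint j y (point 0) >] by [].
apply: asbool_equiv_eq; split=> h; last exact: vint_trans h.
by apply: vint_trans h; exact: vint_sym.
Qed.

Lemma peak_dirichlet j x : (peak j x)%:C%C = dirichlet R (M j) x (point 0).
Proof.
rewrite dirichlet_block // /peak; case: ifP => _ //.
exact: (rmorph_nat (real_complex R)).
Qed.

(** Independence of [j] is the martingale property of the sequence [peak]. *)
Lemma Rintegral_peak j (A : set G) : level j A ->
  Rintegral mu A (peak j) = (point 0 \in A)%:R.
Proof.
move=> lA; rewrite (level_Rintegral m_ge2 hmu (@level_peak j) lA).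
rewrite big_mkcond (bigD1 (Ordinal (M_gt0 j))) //= big1 ?addr0.
  rewrite /peak asboolT; last exact: vint_refl.
  by case: ifP => _; rewrite ?mul0r // divff ?gt_eqF.
move=> i i0; case: ifP => // _; rewrite /peak asboolF // => /(vint_point m_ge2).
rewrite mod0n modn_small // => i0'; case/eqP: i0; exact: val_inj.
Qed.

Lemma peak_diff_le j x :
  `|peak j.+1 x - peak j x| <= (M j.+1)%:R * \1_(vint j (point 0)) x.
Proof.
have sub : vint j.+1 x (point 0) -> vint j x (point 0) by exact: vint_le.
have le : (M j)%:R <= (M j.+1)%:R :> R by rewrite ler_nat leq_gprod.
rewrite /peak indicE; have [h|h] := asboolP (vint j x (point 0)); last first.
  rewrite asboolF; last by move=> /sub.
  by rewrite subrr normr0 mulr_ge0.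
rewrite mem_set; last exact: vint_sym.
rewrite mulr1; case: asboolP => _; last by rewrite sub0r normrN normr_nat.
by rewrite ger0_norm ?subr_ge0 // lerBlDr lerDl.
Qed.

Variable c : nat -> R.
Hypothesis c_ge0 : forall j, 0 <= c j.

Definition hump_sum n (x : G) : R :=
  \sum_(j < n) c j * (peak j.+1 x - peak j x).

Definition hump n (x : G) : R[i] := (hump_sum n x)%:C%C.

Lemma level_hump_sum n : level n (hump_sum n).
Proof.
move=> x y xy; apply: eq_bigr => j _; congr (_ * (_ - _)).
  by apply: (@level_peak j.+1); exact: vint_le xy.
by apply: (@level_peak j); apply: vint_le xy; exact: ltnW.
Qed.

Lemma level_hump n : level n (hump n).
Proof. by move=> x y xy; rewrite /hump (level_hump_sum xy). Qed.

Lemma Rintegral_hump_sum n k (A : set G) : (n <= k)%N -> level n A ->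
  Rintegral mu A (hump_sum k) = Rintegral mu A (hump_sum n).
Proof.
move=> /subnKC<- lA; elim: (k - n)%N => [|d IH]; first by rewrite addn0.
rewrite addnS -IH; set i := (n + d)%N.
have lAi : level i A by apply: level_le lA; exact: leq_addr.
have lAS : level i.+1 A by apply: level_le lAi.
have LR (h : G -> R) : level i.+1 h -> Rintegral mu A h =
    (\sum_(z < M i.+1 | point z \in A) h (point z)) / (M i.+1)%:R.
  by move=> lh; exact: (level_Rintegral m_ge2 hmu lh lAS).
rewrite LR ?(LR (hump_sum i));
  [|exact: level_le (@level_hump_sum i)|exact: level_hump_sum].
under eq_bigr do rewrite /hump_sum big_ord_recr /= -/(hump_sum i _).
rewrite big_split mulrDl /= -[RHS]addr0; congr (_ + _).
rewrite -mulr_sumr sumrB -mulrA mulrBl.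
rewrite -LR; last exact: level_peak.
rewrite -LR; last exact: level_le (@level_peak i).
by rewrite !Rintegral_peak // subrr mulr0.
Qed.

Lemma hump_martingale : martingale mu hump.
Proof.
split=> [n|n|n k A nk FA].
- by apply/(vmeasurableP m_ge2); exact: level_hump.
- split; first exact: (level_integrable m_ge2 mu (level_Re (@level_hump n))).
  exact: (level_integrable m_ge2 mu (level_Im (@level_hump n))).
rewrite /cintegral; congr (_ +i* _)%C.
exact: Rintegral_hump_sum nk (vfiltration_level FA).
Qed.

Lemma cmod_hump n x : cmod (hump n x) <=
  \sum_(j < n) c j * ((M j.+1)%:R * \1_(vint j (point 0)) x).
Proof.
rewrite cmod_real; apply: le_trans (ler_norm_sum _ _ _) _.
apply: ler_sum => j _; rewrite normrM ger0_norm // ler_wpM2l //.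
exact: peak_diff_le.
Qed.

(** The [p]-th power of the maximal function is at most the sum of the [p]-th
    powers of its pieces; the piece of index [j] is at most [c_j * M_(j+1)] on a
    set of measure [1 / M_j]. *)
Lemma hump_hardy (p A : R) : 0 < p <= 1 ->
  (forall n, \sum_(j < n) (c j * (M j)%:R) `^ p / (M j)%:R <= A) ->
  hardy mu p hump.
Proof.
move=> pp hA; have p0 : 0 < p by case/andP: pp.
split; first exact: hump_martingale.
rewrite /hardy_norm unlock /Lnorm.
suff : (\int[mu]_x `|sup_mod hump x| `^ p <= (B%:R `^ p * A)%:E)%E.
  move=> h; apply: (@le_lt_trans _ _ (((B%:R `^ p * A)%:E) `^ p^-1)%E).
    apply: lee_poweR_base => //; first by rewrite invr_ge0 ltW.
    by apply: integral_ge0 => x _; exact: poweR_ge0.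
  by rewrite poweR_EFin ltry.
apply: (integral_sup_mod_le m_ge2 level_hump) => // n.
pose F j x := (c j * (M j.+1)%:R) `^ p * \1_(vint j (point 0)) x.
apply: (@le_trans _ _ (\int[mu]_x (\sum_(j < n) (F j x)%:E)))%E.
  apply: ge0_le_integral => //.
  - by move=> x _; rewrite lee_fin powR_ge0.
  - exact: (measurable_max_upto_powR m_ge2 level_hump).
  - apply: emeasurable_sum => j; apply/measurable_EFinP.
    apply: measurable_funM => //; apply: measurable_indic; exact: measurable_vint.
  move=> x _; rewrite sumEFin lee_fin.
  apply: (@le_trans _ _ ((\sum_(j < n)
      c j * ((M j.+1)%:R * \1_(vint j (point 0)) x)) `^ p)).
    apply: ler_powR_base; [exact: ltW|exact: max_upto_ge0|].
    apply: max_upto_le => [|k kn].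
      by apply: sumr_ge0 => j _; rewrite !mulr_ge0.
    apply: le_trans (cmod_hump _ _) _.
    rewrite (big_ord_widen n (fun j =>
      c j * ((M j.+1)%:R * \1_(vint j (point 0)) x)) (ltnW kn)).
    rewrite big_mkcond; apply: ler_sum => j _.
    by case: ifP => _ //; rewrite !mulr_ge0.
  apply: le_trans (powR_sum_le _ _ pp _) _; first by move=> j; rewrite !mulr_ge0.
  apply: ler_sum => j _; rewrite /F mulrA indicE.
  by case: (x \in _); rewrite ?mulr1 // !mulr0 powR0 ?gt_eqF.
rewrite ge0_integral_sum //; last 2 first.
- move=> j; apply/measurable_EFinP.
  apply: measurable_funM => //; apply: measurable_indic; exact: measurable_vint.
- by move=> j x _; rewrite lee_fin mulr_ge0 ?powR_ge0.
apply: (@le_trans _ _ (\sum_(j < n)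
    ((B%:R `^ p * ((c j * (M j)%:R) `^ p / (M j)%:R))%:E))%E).
  apply: lee_sum => j _; rewrite (level_integral m_ge2 hmu (n := j)); last first.
    move=> x y xy; rewrite /F !indicE; congr (_ * (_ : bool)%:R).
    by rewrite /in_mem /= /in_set (level_vint (point 0) xy).
  rewrite lee_fin /F -mulr_sumr mulrA ler_pM2r ?invr_gt0 //.
  rewrite (bigD1 (Ordinal (M_gt0 j))) //= big1 ?addr0.
    rewrite indicE mem_set ?mulr1 -?powRM ?mulr_ge0 //.
    apply: ler_powR_base; [exact: ltW|by rewrite mulr_ge0|].
    rewrite gprodS natrM mulrA mulrC ler_wpM2r ?mulr_ge0 //.
    by rewrite ler_nat.
  move=> i i0; rewrite indicE memNset // => /(vint_point m_ge2).
  rewrite mod0n modn_small // => i0'; case/eqP: i0; exact: val_inj.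
by rewrite sumEFin lee_fin -mulr_sumr ler_wpM2l ?powR_ge0.
Qed.

(** [peak j] is the sum of the first [M_j] characters, so taking the partial sum
    of order [a] truncates it at [min a M_j]. *)
Lemma vsum_peak n j a x : (j <= n)%N -> (a <= M n)%N ->
  (\sum_(y < M n) (peak j (point y))%:C%C * dirichlet R a x (point y)) / (M n)%:R
  = dirichlet R (minn a (M j)) x (point 0).
Proof.
move=> jn aM.
have Mn0 : ((M n)%:R : R[i]) != 0 by rewrite pnatr_eq0 -lt0n.
have -> : dirichlet R (minn a (M j)) x (point 0) =
    \sum_(l < a | (l < M j)%N) psi l x.
  rewrite /dirichlet.
  rewrite (big_ord_widen a (fun k => psi k x * (psi k (point 0))^*%C));
    last exact: geq_minl.
  apply: eq_big => [l|l _]; first by rewrite ltn_min ltn_ord.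
  by rewrite psi_point0 // conjc1 mulr1.
transitivity (\sum_(y < M n) \sum_(k < M j) \sum_(l < a)
   psi l x * (psi k (point y) * (psi l (point y))^*%C) / (M n)%:R).
  rewrite mulr_suml; apply: eq_bigr => y _.
  rewrite peak_dirichlet /dirichlet !mulr_suml; apply: eq_bigr => k _.
  rewrite mulr_sumr mulr_suml; apply: eq_bigr => l _.
  by rewrite psi_point0 // conjc1 mulr1 mulrCA.
rewrite exchange_big /=.
under eq_bigr do rewrite exchange_big /=.
rewrite exchange_big /= [RHS]big_mkcond; apply: eq_bigr => l _.
have inner (k : 'I_(M j)) : \sum_(y < M n)
     psi l x * (psi k (point y) * (psi l (point y))^*%C) / (M n)%:R =
     if (k : nat) == l then psi l x else 0.
  rewrite -mulr_suml -mulr_sumr psi_orthonormal //.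
  - by case: ifP => _; rewrite ?mulfK // mulr0 mul0r.
  - by apply: leq_trans (ltn_ord k) _; exact: leq_gprod.
  - exact: leq_trans (ltn_ord l) aM.
rewrite (eq_bigr _ (fun k _ => inner k)) -big_mkcond /=.
case: ifP => lM.
  by rewrite (big_pred1 (Ordinal lM)).
by rewrite big_pred0 // => k; apply/eqP => kl; rewrite -kl ltn_ord in lM.
Qed.

(** Only the block of frequencies containing [a] is cut. *)
Lemma vsum_hump a x : (0 < a)%N -> vsum mu a hump x =
  hump (vhigh m a) x +
  (c (vhigh m a))%:C%C * (dirichlet R a x (point 0) - (peak (vhigh m a) x)%:C%C).
Proof.
move=> a0; set t := vhigh m a.
have aM : (a <= M t.+1)%N by apply: ltnW; exact: ltn_gprod_vhigh.
rewrite (vsumE m_ge2 hmu hump_martingale _ aM).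
transitivity (\sum_(j < t.+1) (c j)%:C%C *
  (dirichlet R (minn a (M j.+1)) x (point 0) -
   dirichlet R (minn a (M j)) x (point 0))).
  transitivity (\sum_(y < M t.+1) \sum_(j < t.+1) (c j)%:C%C *
     ((peak j.+1 (point y))%:C%C * dirichlet R a x (point y) / (M t.+1)%:R -
      (peak j (point y))%:C%C * dirichlet R a x (point y) / (M t.+1)%:R)).
    rewrite mulr_suml; apply: eq_bigr => y _.
    rewrite /hump /hump_sum rmorph_sum !mulr_suml; apply: eq_bigr => j _.
    by rewrite rmorphM rmorphB /= -!mulrA -mulrBl.
  rewrite exchange_big /=; apply: eq_bigr => j _.
  rewrite -mulr_sumr sumrB -!mulr_suml !vsum_peak //.
  exact: ltnW.
rewrite big_ord_recr /=; congr (_ + _).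
  rewrite /hump /hump_sum rmorph_sum; apply: eq_bigr => j _.
  have Ma : (M t <= a)%N by exact: gprod_vhigh_le.
  rewrite rmorphM rmorphB /= !peak_dirichlet !(minn_idPr _) //.
    by apply: leq_trans Ma; apply: leq_gprod => //; exact: ltnW.
  by apply: leq_trans Ma; exact: leq_gprod.
by rewrite (minn_idPl aM) peak_dirichlet (minn_idPr _) // gprod_vhigh_le.
Qed.

Lemma dirichlet_split s b r (x y : G) : (M s %| b)%N -> (r <= M s)%N ->
  dirichlet R (b + r) x y = dirichlet R b x y +
    psi b x * (psi b y)^*%C * dirichlet R r x y.
Proof.
move=> sb rs; rewrite /dirichlet big_split_ord /= mulr_sumr; congr (_ + _).
apply: eq_bigr => i _; have iM := leq_trans (ltn_ord i) rs.
by rewrite !(psiD R m_ge2 _ sb iM) conjcM mulrACA.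
Qed.

(** On an atom of level [<a> + 1] just beside the neutral element only the
    lowest nonzero digit of [a] contributes to the Dirichlet kernel [D_a]. *)
Lemma dirichlet_lower a : (0 < a)%N ->
  exists u, [/\ (0 < u)%N, (u < m (vlow m a))%N &
    forall x, vint (vlow m a).+1 (point (u * M (vlow m a))) x ->
      (M (vlow m a))%:R <= B%:R * cmod (dirichlet R a x (point 0))].
Proof.
move=> a0; set s := vlow m a; have [d0 Msa] := vlowP m_ge2 a0; rewrite -/s in d0 Msa.
set d := vdigit m a s in d0; pose q := (a %/ M s %/ m s)%N.
have aE : a = (q * M s.+1 + d * M s)%N.
  rewrite -[LHS](divnK Msa) {1}(divn_eq (a %/ M s) (m s)) mulnDl gprodS.
  by rewrite -/q mulnA mulnAC.
have dm : (0 < d < m s)%N by rewrite lt0n d0 vdigit_lt.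
have [u [u0 um Ku]] := unit_root_sum_lower R dm.
exists u; split=> // x xu.
have xs k : (k <= s)%N -> x k = (if k == s then u else 0%N) :> nat.
  move=> ks; rewrite xu // pointE //.
  case: eqVneq => [->|ne].
    by rewrite /vdigit mulnK // modn_small.
  apply: (vdigit_dvd m_ge2 (s := s)); first exact: dvdn_mull.
  by rewrite ltn_neqAle ne.
have x0 : vint s x (point 0).
  move=> k ks; apply: ord_inj; rewrite pointE // vdigit_small // xs ?(ltnW ks) //.
  by rewrite ltn_eqF.
have x1 : ~ vint s.+1 x (point 0).
  move=> /(_ s (ltnSn s)) /(congr1 (@nat_of_ord _)).
  rewrite pointE // vdigit_small // xs // eqxx => u0'.
  by rewrite -u0' in u0.
have dMs : (d * M s <= M s.+1)%N.
  by rewrite gprodS mulnC leq_mul2l ltnW ?orbT // vdigit_lt.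
rewrite aE (@dirichlet_split s.+1) ?dvdn_mull //.
rewrite (@dirichlet_eq0 R m m_ge2 s.+1) ?dvdn_mull // add0r.
rewrite !cmodM cmodJ !cmod_psi !mul1r dirichlet_mul // dirichlet_block //.
rewrite asboolT // cmodM cmod_nat mulrA ler_peMl //.
have -> : \sum_(l < d) psi (l * M s) x * (psi (l * M s) (point 0))^*%C =
    \sum_(l < d) (unit_root R (m s) ^+ u) ^+ l.
  apply: eq_bigr => l _; rewrite psi_point0 // conjc1 mulr1.
  have lm : (l < m s)%N by apply: ltn_trans (ltn_ord l) _; exact: vdigit_lt.
  rewrite (@psi_wide _ _ m_ge2 s.+1); last by rewrite gprodS mulnC ltn_pmul2l.
  rewrite big_ord_recr /= big1 ?mul1r.
    by rewrite rademacherE // xs // eqxx /vdigit mulnK // (modn_small lm).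
  move=> k _; rewrite (vdigit_dvd m_ge2 (s := s)) ?expr0 //.
  exact: dvdn_mull.
apply: le_trans Ku _; rewrite ler_wpM2r ?cmod_ge0 //.
by rewrite ler_nat.
Qed.

Lemma level_vsum_hump a : level (vhigh m a).+1 (vsum mu a hump).
Proof.
move=> x y xy; apply: eq_bigr => k _.
have ka : (k < M (vhigh m a).+1)%N.
  by apply: ltn_trans (ltn_ord k) _; exact: ltn_gprod_vhigh.
by rewrite (level_psi R m_ge2 ka xy).
Qed.

(** On the atom of [dirichlet_lower] the earlier pieces cost at most half of the
    lower bound [c_t * M_s / B] for the cut block, and [peak t] vanishes. *)
Lemma weak_Lnorm_hump (p : R) a : 0 < p -> (0 < a)%N ->
  (vlow m a < vhigh m a)%N -> 0 < c (vhigh m a) ->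
  2 * B%:R * \sum_(j < vhigh m a) c j * (M j.+1)%:R <=
    c (vhigh m a) * (M (vlow m a))%:R ->
  (((c (vhigh m a) * (M (vlow m a))%:R) / (4 * B%:R) *
     ((M (vlow m a).+1)%:R^-1) `^ p^-1)%:E <= weak_Lnorm mu p (vsum mu a hump))%E.
Proof.
move=> p0 a0; set s := vlow m a; set t := vhigh m a => st ct small.
have B0 : 0 < B%:R :> R by rewrite ltr0n (leq_trans _ (m_leB 0)) // ltnW.
have [u [u0 um lower]] := dirichlet_lower a0; rewrite -/s in um lower.
set l := c t * (M s)%:R / (4 * B%:R).
have l0 : 0 < l by rewrite /l !(mulr_gt0, invr_gt0).
have large x : vint s.+1 (point (u * M s)) x -> l < cmod (vsum mu a hump x).
  move=> xu; rewrite vsum_hump // -/t.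
  have x1 : peak t x = 0.
    rewrite /peak asboolF // => /(vint_le st) /(vint_trans xu) /(vint_point m_ge2).
    rewrite mod0n modn_small ?gprodS 1?mulnC ?ltn_pmul2l // => /eqP.
    by rewrite muln_eq0 !gtn_eqF.
  rewrite x1 subr0 addrC -[X in _ + X]opprK.
  apply: lt_le_trans (cmodB _ _); rewrite cmodN cmodM cmod_real ger0_norm //.
  have hump_le : cmod (hump t x) <= \sum_(j < t) c j * (M j.+1)%:R.
    apply: le_trans (cmod_hump _ _) _; apply: ler_sum => j _.
    rewrite ler_wpM2l // ler_piMr // indicE; by case: (_ \in _).
  have := lower x xu; set K := cmod _ => hK.
  have lE : 4 * B%:R * l = c t * (M s)%:R.
    by rewrite /l mulrC divfK // mulf_neq0 ?gt_eqF.
  set H := cmod (hump t x) in hump_le *; set S := \sum_(_ < _) _ in small hump_le.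
  rewrite -(ltr_pM2l B0) mulrBr.
  have h1 : B%:R * H <= B%:R * S by rewrite ler_pM2l.
  have h2 : c t * (M s)%:R <= c t * (B%:R * K) by rewrite ler_pM2l.
  have h3 : 0 < B%:R * l by rewrite mulr_gt0.
  have h4 : B%:R * (c t * K) = c t * (B%:R * K) by rewrite mulrCA.
  rewrite h4; lra.
have : (l%:E * mu [set x | (l < cmod (vsum mu a hump x))%R] `^ p^-1 <=
    weak_Lnorm mu p (vsum mu a hump))%E.
  by apply: ereal_sup_ubound; exists l.
apply: le_trans.
  rewrite EFinM lee_wpmul2l ?lee_fin ?(ltW l0) //.
  rewrite -poweR_EFin; apply: lee_poweR_base.
  - by rewrite invr_ge0 ltW.
  - by rewrite lee_fin invr_ge0.
  rewrite -(mu_vint hmu s.+1 (point (u * M s))).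
  apply: le_measure; rewrite ?inE //; first exact: measurable_vint.
  apply: (@vfiltration_measurable m (vhigh m a).+1); apply: level_vfiltration => //.
  by move=> x y xy; rewrite /mkset (level_vsum_hump xy).
Qed.

End LacunaryMartingale.

(** * Choice of the coefficients *)

Section LacunaryCoefficients.
Variables (R : realType) (m : nat -> nat).
Hypothesis m_ge2 : forall k, (2 <= m k)%N.
Variable B : nat.
Hypothesis m_leB : forall k, (m k <= B)%N.
Local Notation M := (gprod m).
Variables (p : R) (alpha : nat -> nat).
Hypothesis p01 : 0 < p < 1.
Hypothesis rho_unbounded : forall N, exists k, (N <= vrho m (alpha k))%N.

Let p_gt0 : 0 < p. Proof. by case/andP: p01. Qed.
Let delta := p^-1 - 1.
Let delta_gt0 : 0 < delta.
Proof. by rewrite subr_gt0 invf_gt1 //; case/andP: p01. Qed.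

Let MR_gt0 k : 0 < (M k)%:R :> R.
Proof. by rewrite ltr0n gprod_gt0. Qed.

Let MR_neq0 k : (M k)%:R != 0 :> R. Proof. by rewrite gt_eqF. Qed.

Let B_gt0 : 0 < B%:R :> R.
Proof. by rewrite ltr0n (leq_trans _ (m_leB 0)) // ltnW. Qed.

Lemma powRV (a r : R) : 0 <= a -> a^-1 `^ r = (a `^ r)^-1.
Proof. by move=> a0; rewrite -powR_inv1 // -powRrM mulN1r powRN. Qed.

Lemma powR_expn_unbounded (X d : R) : 0 < d ->
  exists N, forall r, (N <= r)%N -> X <= ((2 ^ r)%N)%:R `^ d.
Proof.
move=> d0; pose x : R := `|X| `^ d^-1.
have x0 : 0 <= x by exact: powR_ge0.
exists (Num.bound x) => r Nr.
apply: le_trans (ler_norm X) _; rewrite -[leLHS](@powR_invK _ d) ?gt_eqF //.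
apply: ler_powR_base => //; first exact: ltW.
apply: ltW; apply: lt_trans (archi_boundP x0) _.
by rewrite ltr_nat; apply: leq_ltn_trans Nr (ltn_expl _ _).
Qed.

Lemma gprod_ratio_ge s t : (s <= t)%N -> (2 ^ (t - s) * M s <= M t)%N.
Proof.
move=> /subnKC<-; rewrite addKn; elim: (t - s)%N => [|d IH].
  by rewrite addn0 expn0 mul1n.
by rewrite addnS gprodS expnSr mulnAC leq_mul.
Qed.

(** Chosen so that the [p]-th powers of the weights are summable, with sum 2. *)
Definition weight k : R := (2 ^- k) `^ p^-1.
(** Normalizes the hump of index [j] to bounded norm in [H_p]. *)
Definition scale j : R := (M j)%:R `^ delta.

Lemma weight_gt0 k : 0 < weight k.
Proof. by rewrite powR_gt0 // invr_gt0 exprn_gt0. Qed.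

Lemma weight_le1 k : weight k <= 1.
Proof.
have -> : 1 = 1 `^ p^-1 :> R by rewrite powR1.
rewrite /weight; apply: ler_powR_base.
- by rewrite invr_ge0 ltW.
- by rewrite invr_ge0 exprn_ge0.
- by rewrite invf_le1 ?exprn_gt0 // exprn_ege1 // ler1n.
Qed.

Lemma scale_gt0 j : 0 < scale j. Proof. exact: powR_gt0. Qed.

(** The third condition lets the new hump dominate everything placed below [T],
    by the crude bound [coef_le]; the fourth pushes the weak norm above [k]. *)
Definition good k T i : Prop :=
  let s := vlow m (alpha i) in let t := vhigh m (alpha i) in
  [/\ (T <= t)%N, (s < t)%N,
    2 * B%:R * (\sum_(j < T) j.+1%:R * scale j * (M j.+1)%:R) <=
      weight k * scale t &
    k%:R * (4 * B%:R * B%:R `^ p^-1) <=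
      weight k * ((M t)%:R / (M s)%:R) `^ delta].

Lemma good_exists k T : exists i, good k T i.
Proof.
set X1 := 2 * B%:R * (\sum_(j < T) j.+1%:R * scale j * (M j.+1)%:R).
set X2 := k%:R * (4 * B%:R * B%:R `^ p^-1).
have [N hN] := powR_expn_unbounded (Num.max X1 X2 / weight k) delta_gt0.
have [i hi] := rho_unbounded (maxn N (maxn T 1)).
exists i; rewrite /good; set s := vlow _ _; set t := vhigh _ _.
have hi' : (maxn N (maxn T 1) <= t - s)%N by exact: hi.
have [hNi hTi h1] : [/\ N <= t - s, T <= t - s & 0 < t - s]%N.
  by move: hi'; rewrite !geq_max => /and3P[].
have st : (s < t)%N by rewrite -subn_gt0.
have ratio : ((2 ^ (t - s))%N)%:R <= (M t)%:R / (M s)%:R :> R.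
  by rewrite ler_pdivlMr // -natrM ler_nat gprod_ratio_ge // ltnW.
have big : Num.max X1 X2 <= weight k * ((M t)%:R / (M s)%:R) `^ delta.
  rewrite mulrC -ler_pdivrMr ?weight_gt0 //; apply: le_trans (hN _ hNi) _.
  by apply: ler_powR_base => //; exact: ltW.
rewrite ge_max in big; case/andP: big => big1 big2.
split=> //; first by apply: leq_trans hTi _; exact: leq_subr.
apply: le_trans big1 _; rewrite ler_pM2l ?weight_gt0 //.
apply: ler_powR_base; [exact: ltW|by rewrite divr_ge0|].
by rewrite ler_pdivrMr // ler_peMr // ler1n gprod_gt0.
Qed.

(** The default value is never returned, by [good_exists]. *)
Definition pick k T : nat := xget 0%N [set i | good k T i].

Lemma pickP k T : good k T (pick k T).
Proof. by have [i gi] := good_exists k T; exact: (xgetI _ gi). Qed.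

(** One more than the index of the latest hump before stage [k]. *)
Fixpoint threshold k : nat :=
  if k is k'.+1 then (vhigh m (alpha (pick k' (threshold k')))).+1 else 0%N.

Definition stage k : nat := pick k (threshold k).
Definition top k : nat := vhigh m (alpha (stage k)).
Definition bottom k : nat := vlow m (alpha (stage k)).

Lemma stageP k : good k (threshold k) (stage k).
Proof. exact: pickP. Qed.

Lemma top_lt k k' : (k < k')%N -> (top k < threshold k')%N.
Proof.
elim: k' => // k' IH; rewrite ltnS leq_eqVlt => /predU1P[->|kk'].
  exact: ltnSn.
apply: leq_trans (IH kk') _; rewrite /= -/(stage k') -/(top k').
by apply: leqW; case: (stageP k').
Qed.

Lemma threshold_le_top k : (threshold k <= top k)%N.
Proof. by case: (stageP k). Qed.

Lemma leq_top k : (k <= top k)%N.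
Proof.
elim: k => // k IH; apply: leq_ltn_trans IH _.
exact: leq_trans (top_lt (ltnSn k)) (threshold_le_top _).
Qed.

(** The humps sit at the indices [top k]; since [k <= top k], only the indices
    [k <= j] need be searched. *)
Definition coef j : R := \sum_(k < j.+1 | top k == j) weight k * scale j.

Lemma coef_ge0 j : 0 <= coef j.
Proof.
by apply: sumr_ge0 => k _; rewrite mulr_ge0 // ltW ?weight_gt0 ?scale_gt0.
Qed.

Lemma coef_le j : coef j <= j.+1%:R * scale j.
Proof.
rewrite /coef big_mkcond /=; apply: (@le_trans _ _ (\sum_(k < j.+1) scale j)).
  apply: ler_sum => k _; case: ifP => _; last by rewrite ltW ?scale_gt0.
  by rewrite ler_piMl ?weight_le1 // ltW ?scale_gt0.
by rewrite sumr_const card_ord mulr_natl.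
Qed.

Lemma coef_top_ge k : weight k * scale (top k) <= coef (top k).
Proof.
have kt : (k < (top k).+1)%N by rewrite ltnS leq_top.
rewrite /coef (bigD1 (Ordinal kt)) //= lerDl.
by apply: sumr_ge0 => i _; rewrite mulr_ge0 // ltW ?weight_gt0 ?scale_gt0.
Qed.

Lemma coef_top_gt0 k : 0 < coef (top k).
Proof.
by apply: lt_le_trans (coef_top_ge k); rewrite mulr_gt0 ?weight_gt0 ?scale_gt0.
Qed.

Lemma coef_gap k j : (threshold k <= j < top k)%N -> coef j = 0.
Proof.
move=> /andP[Tj jt]; rewrite /coef big1 // => i /eqP ij.
case: (ltnP i k) => ik.
  by have := top_lt ik; rewrite ij ltnNge Tj.
have : (top k <= top i)%N.
  move: ik; rewrite leq_eqVlt => /predU1P[->//|ki]; apply: ltnW.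
  exact: leq_trans (top_lt ki) (threshold_le_top _).
by rewrite ij leqNgt jt.
Qed.

Lemma coef_dominates k :
  2 * B%:R * \sum_(j < top k) coef j * (M j.+1)%:R <=
  coef (top k) * (M (bottom k))%:R.
Proof.
have [_ _ h _] := stageP k; rewrite -/(top k) in h.
apply: (@le_trans _ _ (weight k * scale (top k))); last first.
  apply: le_trans (coef_top_ge k) _; rewrite ler_peMr ?coef_ge0 //.
  by rewrite ler1n gprod_gt0.
apply: le_trans h; rewrite ler_wpM2l ?mulr_ge0 ?(ltW B_gt0) //.
rewrite (big_ord_widen (top k) (fun j => j.+1%:R * scale j * (M j.+1)%:R)
  (threshold_le_top k)) [leRHS]big_mkcond; apply: ler_sum => j _.
case: (ltnP j (threshold k)) => jT.
  by rewrite ler_wpM2r // coef_le.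
by rewrite (@coef_gap k) ?mul0r // jT ltn_ord.
Qed.

Lemma sum_half_le n : \sum_(k < n) (2 : R) ^- k <= 2.
Proof.
suff -> : \sum_(k < n) (2 : R) ^- k = 2 - 2 * 2 ^- n.
  by rewrite gerBl mulr_ge0 // invr_ge0 exprn_ge0.
elim: n => [|n IH]; first by rewrite big_ord0 expr0 invr1 mulr1 subrr.
rewrite big_ord_recr /= IH exprS invfM mulrA mulfV // mul1r.
by rewrite -addrA; congr (_ + _); rewrite mulr_natl mulr2n opprD -addrA addNr addr0.
Qed.

(** Subadditivity splits the sum defining [coef j], and a hump of stage [k]
    contributes exactly the [p]-th power [2 ^- k] of its weight. *)
Lemma coef_summable n :
  \sum_(j < n) (coef j * (M j)%:R) `^ p / (M j)%:R <= 2.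
Proof.
have p0' : p != 0 by rewrite gt_eqF.
apply: (@le_trans _ _ (\sum_(j < n) \sum_(k < n | top k == j) 2 ^- k)).
  apply: ler_sum => j _; rewrite /coef mulr_suml ler_pdivrMr //.
  have pp : 0 < p <= 1 by case/andP: p01 => -> /ltW.
  apply: (@le_trans _ _ (\sum_(k < j.+1 | top k == j)
      (weight k * scale j * (M j)%:R) `^ p)).
    apply: powR_sum_le => // k.
    by rewrite !mulr_ge0 // ltW ?weight_gt0 ?scale_gt0.
  rewrite mulr_suml (big_ord_widen_cond n (fun k => top k == j)
     (fun k => (weight k * scale j * (M j)%:R) `^ p) (ltn_ord j)).
  rewrite big_mkcond [leRHS]big_mkcond; apply: ler_sum => k _.
  case: (top k == j) => //=; case: ifP => _; last first.
    by rewrite mulr_ge0 // invr_ge0 exprn_ge0.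
  have sM : scale j * (M j)%:R = (M j)%:R `^ p^-1.
    by rewrite /scale -[X in _ * X]powRr1 // -powRD ?MR_neq0 ?implybT // subrK.
  rewrite -mulrA sM powRM ?powR_ge0 // /weight !powR_invK //.
apply: le_trans (sum_half_le n).
rewrite (exchange_big_dep predT) //=; apply: ler_sum => k _.
rewrite big_mkcond /=.
case: (ltnP (top k) n) => kn; last first.
  rewrite big1 ?invr_ge0 ?exprn_ge0 // => j _.
  by case: eqP => // kj; rewrite kj leqNgt ltn_ord in kn.
rewrite (bigD1 (Ordinal kn)) //= eqxx big1 ?addr0 // => j jk.
by case: eqP => // kj; case/eqP: jk; exact: val_inj.
Qed.

(** The powers of [M_s] combine to [(M_t / M_s) ^ (1 / p - 1)], the quantity
    controlled by [good]. *)
Lemma coef_large k :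
  k%:R <= (coef (top k) * (M (bottom k))%:R) / (4 * B%:R) *
     ((M (bottom k).+1)%:R^-1) `^ p^-1.
Proof.
have [_ _ _ h] := stageP k; rewrite -/(top k) -/(bottom k) in h.
set t := top k in h *; set s := bottom k in h *.
have Bp : 0 < B%:R `^ p^-1 by exact: powR_gt0.
have low : (B%:R * (M s)%:R)^-1 `^ p^-1 <= ((M s.+1)%:R^-1) `^ p^-1.
  apply: ler_powR_base.
  - by rewrite invr_ge0 ltW.
  - by rewrite invr_ge0 mulr_ge0 // ltW.
  rewrite lef_pV2 ?posrE ?mulr_gt0 // gprodS natrM mulrC ler_wpM2r //.
  by rewrite ler_nat.
apply: (@le_trans _ _ (weight k * scale t * (M s)%:R / (4 * B%:R) *
   (B%:R * (M s)%:R)^-1 `^ p^-1)); last first.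
  apply: ler_pM => //.
    by rewrite !mulr_ge0 ?invr_ge0 ?mulr_ge0 // ?ltW ?weight_gt0 ?scale_gt0.
  rewrite ler_wpM2r ?invr_ge0 ?mulr_ge0 ?(ltW B_gt0) // ler_wpM2r //.
  exact: coef_top_ge.
have B4 : 0 < 4 * B%:R :> R by rewrite mulr_gt0.
rewrite -(ler_pM2r (mulr_gt0 B4 Bp)); apply: le_trans h _.
rewrite le_eqVlt; apply/orP; left; apply/eqP.
have -> : (B%:R * (M s)%:R)^-1 `^ p^-1 =
    (B%:R `^ p^-1)^-1 * ((M s)%:R `^ p^-1)^-1 :> R.
  by rewrite invfM powRM ?invr_ge0 ?(ltW B_gt0) // !powRV // ltW.
have -> : ((M t)%:R / (M s)%:R) `^ delta =
    scale t * ((M s)%:R / (M s)%:R `^ p^-1).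
  rewrite powRM ?invr_ge0 // /scale; congr (_ * _).
  rewrite powRV // -powRN -[X in X / _]powRr1 // -powRN.
  rewrite -powRD ?MR_neq0 ?implybT //; congr (_ `^ _).
  by rewrite /delta opprB.
have Bp' := gt_eqF Bp; have B4' := gt_eqF B4.
have Msp : (M s)%:R `^ p^-1 != 0 :> R by rewrite gt_eqF // powR_gt0.
by field; rewrite Msp Bp' /= gt_eqF.
Qed.

End LacunaryCoefficients.

(** * The two halves of the theorem *)

Lemma bounded_of_ereal_sup_lty (R : realType) (r : nat -> nat) :
  (ereal_sup (range (fun k => ((r k)%:R : R)%:E)) < +oo)%E ->
  exists kappa, forall k, (r k <= kappa)%N.
Proof.
set S := ereal_sup _ => Soo.
have ub k : ((r k)%:R%:E <= S)%E by apply: ereal_sup_ubound; exists k.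
have := ub 0%N; move: Soo ub; case: S => [s| |] // _ ub _.
have s0 : 0 <= s by have := ub 0%N; rewrite lee_fin; apply: le_trans.
exists (Num.bound s) => k; rewrite -(ler_nat R).
apply: le_trans (ltW (archi_boundP s0)).
by have := ub k; rewrite lee_fin.
Qed.

Lemma unbounded_of_ereal_sup_eqy (R : realType) (r : nat -> nat) :
  (ereal_sup (range (fun k => ((r k)%:R : R)%:E)) = +oo)%E ->
  forall N, exists k, (N <= r k)%N.
Proof.
move=> Soo N; apply: contrapT => h.
suff : (ereal_sup (range (fun k => ((r k)%:R : R)%:E)) <= (N%:R)%:E)%E.
  by rewrite Soo.
apply: ge_ereal_sup => _ [k _ <-]; rewrite lee_fin ler_nat leqNgt.
by apply/negP => Nk; apply: h; exists k; exact: ltnW.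
Qed.

Unset Implicit Arguments.

Theorem theorem1 (R : realType) (m : nat -> nat) (hm : bounded_generating m)
    (mu : probability (Gm m) R) (hmu : is_product_measure mu) :
  (forall (p : R) (alpha : nat -> nat),
    0 < p <= 1 ->
    (forall k, (0 < alpha k)%N) -> {homo alpha : i j / (i < j)%N} ->
    (ereal_sup (range (fun k => ((vrho m (alpha k))%:R : R)%:E)) < +oo)%E ->
    exists C : R, forall f, hardy mu p f ->
      (Lnorm mu p%:E (sup_mod (fun k => vsum mu (alpha k) f))
         <= C%:E * hardy_norm mu p f)%E)
  /\
  (forall (p : R) (alpha : nat -> nat),
    0 < p < 1 ->
    (forall k, (0 < alpha k)%N) -> {homo alpha : i j / (i < j)%N} ->
    (ereal_sup (range (fun k => ((vrho m (alpha k))%:R : R)%:E)) = +oo)%E ->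
    exists2 f, hardy mu p f &
      (ereal_sup (range (fun k => weak_Lnorm mu p (vsum mu (alpha k) f)))
         = +oo)%E).
Proof.
case: hm => m_ge2 [B m_leB]; split=> p alpha.
  move=> /andP[p0 _] alpha_gt0 _ /bounded_of_ereal_sup_lty[kappa rho_le].
  (* Doob's inequality in L^2 is applied to the power [p / 2] *)
  have q0 : 0 < p / 2 by rewrite divr_gt0.
  have pE : p = p / 2 * 2 by rewrite divfK.
  rewrite pE; eexists => f [mf _].
  exact: (Lnorm_max_vsum m_ge2 m_leB hmu q0 mf alpha_gt0 rho_le).
move=> /andP[p0 p1] alpha_gt0 _ /unbounded_of_ereal_sup_eqy rho_unb.
have p01 : 0 < p < 1 by rewrite p0.
have c0 : forall j, 0 <= coef m B p alpha j by exact: coef_ge0.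
exists (hump (coef m B p alpha)).
  apply: (hump_hardy m_ge2 m_leB hmu c0 (A := 2)); first by rewrite p0 ltW.
  by move=> n; exact: coef_summable.
apply: eq_infty => r.
have [k rk] : exists k : nat, r <= k%:R.
  exists (Num.bound `|r|); apply: le_trans (ler_norm r) _.
  exact/ltW/archi_boundP.
have st : (bottom m B p alpha k < top m B p alpha k)%N.
  by case: (stageP m_ge2 B p01 rho_unb k).
apply: (@le_trans _ _ (weak_Lnorm mu p
   (vsum mu (alpha (stage m B p alpha k)) (hump (coef m B p alpha))))).
  apply: le_trans (weak_Lnorm_hump m_ge2 m_leB hmu c0 p0 (alpha_gt0 _) st _ _).
  - rewrite lee_fin; apply: le_trans rk _; exact: coef_large.
  - exact: coef_top_gt0.
  - exact: coef_dominates.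
by apply: ereal_sup_ubound; exists (stage m B p alpha k).
Qed.
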